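(* Let $G=G_1\times\mathbb{C}\subset\mathbb{C}^2$ and let $V=(v_k)_{k=1}^{\infty}$ be the decreasing sequence of weights on $G$ defined in the context. Then the space $H\overline V(G)$ is not bornological; the equality $\mathcal{V}H(G)=H\overline V(G)$ does not hold topologically; $\mathcal{V}H(G)$ is not a topological subspace of $\mathcal{V}C(G)$ (that is, the inductive limit topology of $\mathcal{V}H(G)$ is not the topology induced on it by $\mathcal{V}C(G)$); and $\mathcal{V}H(G)$ is not a Montel space. Moreover, $H\overline V(G)$ is not a (DF)-space.
   Context: All vector spaces are over $\mathbb{C}$; $\mathbb{R}^+$ is the set of strictly positive reals, $\mathbb{R}^+_0=\mathbb{R}^+\cup\{0\}$, $\mathbb{N}=\{1,2,\dots\}$. Weighted spaces. Let $G$ be an open subset of $\mathbb{C}^N$ and $V=(v_k)_{k=1}^\infty$ a (pointwise) decreasing sequence of continuous strictly positive functions on $G$. $Cv_k(G)$ (resp. $Hv_k(G)$) is the Banach space of continuous (resp. holomorphic) $f:G\to\mathbb{C}$ with $p_{v_k}(f):=\sup_{z\in G}v_k(z)|f(z)|<\infty$. Put $\mathcal{V}C(G)={\rm ind}_k\,Cv_k(G)$ and $\mathcal{V}H(G)={\rm ind}_k\,Hv_k(G)$ (locally convex inductive limits). Let $\overline V$ be the set of all continuous $\overline v:G\to\mathbb{R}^+$ such that for every $k$ there is $C_k>0$ with $\overline v\le C_kv_k$ on $G$. The projective hull $C\overline V(G)$ (resp. $H\overline V(G)$) is the space of all continuous (resp. holomorphic) $f:G\to\mathbb{C}$ with $p_{\overline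 v}(f):=\sup_{z\in G}\overline v(z)|f(z)|<\infty$ for all $\overline v\in\overline V$, with the locally convex topology given by the seminorms $p_{\overline v}$, $\overline v\in\overline V$. It is known that $\mathcal{V}C(G)=C\overline V(G)$ and $\mathcal{V}H(G)=H\overline V(G)$ always hold algebraically, with continuous inclusions $\mathcal{V}C(G)\hookrightarrow C\overline V(G)$ and $\mathcal{V}H(G)\hookrightarrow H\overline V(G)$. The sequence $\Lambda$. Let $\Lambda=(\lambda_k)_{k=1}^\infty$ be a decreasing sequence of strictly positive functions on $\mathbb{N}$, $\lambda_{nk}:=\lambda_k(n)$. Let $\overline\Lambda$ be the set of all $\overline\lambda:\mathbb{N}\to\mathbb{R}^+$ such that for every $k$ there is $C_k>0$ with $\overline\lambda\le C_k\lambda_k$ on $\mathbb{N}$, and let $K_\infty$ be the space of all complex sequences $x=(x_n)$ with $p_{\overline\lambda}(x):=\sup_n\overline\lambda(n)|x_n|<\infty$ for all $\overline\lambda\in\overline\Lambda$, topologized by the seminorms $p_{\overline\lambda}$. Throughout, $\Lambda$ is fixed such that $1/n^2\le\lambda_{nk}\le1$ for all $n,k$, and the space $K_\infty$ is not bornological and contains bounded sets which are not metrizable (such $\Lambda$ are known to exist). The weights on $G_1$. Let $G_1=\{z\in\mathbb{C}: 1/2<|z|<1,\ 0<\arg z<\pi\}$. For $n\in\mathbb{N}$ put $\theta_n=1/(2n)$, $I_n=[\theta_n-1/(2^5n^2),\theta_n+1/(2^5n^2)]$, $p_n=\theta_n+1/(2^4n^2)$. Define $w_k(re^{i\theta})=\hat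 w_k(\theta)$ for $re^{i\theta}\in G_1$, where $\hat w_k:[0,\pi]\to\mathbb{R}^+$ satisfies $\hat w_k=\lambda_{nk}$ on $I_n$ for all $n$, $\hat w_k(p_n)=\hat w_k(0)=\hat w_k(\pi)=1$ for all $n$, and $\hat w_k$ is affine on each of the remaining intervals $[\theta_n+1/(2^5n^2),p_n]$, $[p_{n+1},\theta_n-1/(2^5n^2)]$ $(n\in\mathbb{N})$ and $[p_1,\pi]$. The weights on $G$. Let $G=G_1\times\mathbb{C}$ and let $d(z_1)$ be the distance of $z_1\in G_1$ to the complement of $G_1$. Define $v_k(z_1,z_2)=w_k(z_1)\,u_k(z_1,|z_2|)$, where $u_k:G_1\times\mathbb{R}^+_0\to\mathbb{R}^+$ is given by $u_k(z_1,t)=(1+t)^{-\frac{k-1}{2k}}$ for $t\ge k+1$, $u_k(z_1,t)=\bigl(1+\frac1{d(z_1)}+t\bigr)^{-\frac{k-1}{2k}}$ for $t\le k$, and for each fixed $z_1$, $u_k(z_1,\cdot)$ is affine on $[k,k+1]$. Then $V=(v_k)$ is a decreasing sequence of continuous strictly positive weights on $G$. *)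

(* Defs.v *)
From HB Require Import structures.
From mathcomp Require Import all_boot all_order all_algebra.
From mathcomp Require Import all_classical all_reals all_analysis.
From mathcomp Require Import complex.
From mathcomp Require Import ring lra.

Set Implicit Arguments.
Unset Strict Implicit.
Unset Printing Implicit Defensive.
Import Order.TTheory GRing.Theory Num.Theory.
Import numFieldNormedType.Exports.
Local Open Scope classical_set_scope.
Local Open Scope ring_scope.

Notation cnorm := ComplexField.Normc.normc.

Section Cnorm.
Context {R : realType}.
Implicit Types x y : R[i].

Lemma cnormE x : (cnorm x)%:C%C = `|x|.
Proof. by case: x. Qed.

Lemma cnorm_ge0 x : 0 <= cnorm x.
Proof. by case: x => a b /=; exact: sqrtr_ge0. Qed.

Lemma cnormD x y : cnorm (x + y) <= cnorm x + cnorm y.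
Proof. by rewrite -lecR rmorphD /= !cnormE ler_normD. Qed.

Lemma cnormN x : cnorm (- x) = cnorm x.
Proof. by apply: complexI; rewrite !cnormE normrN. Qed.

End Cnorm.

Record seminorm (R : realType) (E : lmodType R[i]) := Seminorm {
  sn_fun :> E -> R;
  snD : forall x y, sn_fun (x + y) <= sn_fun x + sn_fun y;
  snZ : forall a x, sn_fun (a *: x) = cnorm a * sn_fun x }.

Section SeminormTheory.
Context {R : realType} {E : lmodType R[i]} (p : seminorm E).

Lemma sn0 : p 0 = 0.
Proof. by rewrite -[X in p X](scale0r (0 : E)) snZ ComplexField.Normc.normc0 mul0r. Qed.

Lemma snN x : p (- x) = p x.
Proof. by rewrite -scaleN1r snZ cnormN ComplexField.Normc.normc1 mul1r. Qed.

Lemma sn_ge0 x : 0 <= p x.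
Proof.
have := snD p x (- x); rewrite subrr sn0 snN; lra.
Qed.

End SeminormTheory.

(* [E] with the locally convex topology generated by the family [P] *)
Definition lc_space (R : realType) (E : lmodType R[i])
  (P : set (seminorm E)) : Type := E.

Section LcSpace.
Context {R : realType} {E : lmodType R[i]} (P : set (seminorm E)).
Local Notation L := (lc_space P).

HB.instance Definition _ := GRing.Lmodule.on L.

Definition lc_ball (n : nat) (p : 'I_n -> seminorm E) (e : R) (x : E) : set E :=
  [set y | forall i, p i (y - x) < e].

Definition lc_nbhs (x : L) : set_system L :=
  [set A | exists n (p : 'I_n -> seminorm E) e,
    [/\ 0 < e, forall i, P (p i) & lc_ball p e x `<=` A]].

HB.instance Definition _ := hasNbhs.Build L lc_nbhs.

Let lc_ball_center n (p : 'I_n -> seminorm E) e x : 0 < e -> lc_ball p e x x.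
Proof. by move=> e0 i; rewrite subrr sn0. Qed.

Let lc_nbhs_filter (x : L) : ProperFilter (nbhs x).
Proof.
split; first by move=> [n [p [e [e0 _]]]] /(_ x); apply; exact: lc_ball_center.
split.
- have p0 : 'I_0 -> seminorm E by case.
  by exists 0%N, p0, 1; split => // -[].
- move=> A B [m [p [e [e0 Pp pA]]]] [n [q [d [d0 Pq qB]]]].
  exists (m + n)%N, (fun i : 'I_(m + n) => match fintype.split i with inl j => p j | inr j => q j end),
    (Num.min e d); split.
  + by rewrite lt_min e0.
  + by move=> i; case: (fintype.split i).
  + move=> y yb; split.
      apply: pA => i; have := yb (lshift n i).
      by rewrite -[lshift n i]/(unsplit (inl i)) unsplitK lt_min => /andP[].
    apply: qB => i; have := yb (rshift m i).
    by rewrite -[rshift m i]/(unsplit (inr i)) unsplitK lt_min => /andP[].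
- move=> A B AB [n [p [e [e0 Pp pA]]]].
  by exists n, p, e; split => //; exact: subset_trans AB.
Qed.

Let lc_nbhs_singleton (x : L) (A : set L) : nbhs x A -> A x.
Proof. by move=> [n [p [e [e0 _]]]]; apply; exact: lc_ball_center. Qed.

Let lc_ball_nbhs n (p : 'I_n -> seminorm E) e (x y : L) :
  (forall i, P (p i)) -> 0 < e -> lc_ball p e x y ->
  nbhs y (lc_ball p e x : set L).
Proof.
move=> Pp e0 xy; pose d := \big[Num.min/e]_(i < n) (e - p i (y - x)).
have d0 : 0 < d.
  rewrite /d; elim/big_ind: _ => // [a b a0 b0|i _]; first by rewrite lt_min a0.
  by rewrite subr_gt0.
exists n, p, d; split => // z yz i.
have di : d <= e - p i (y - x) by rewrite /d; exact: bigmin_le_cond.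
have := snD (p i) (z - y) (y - x); rewrite addrA subrK => h.
by move: (yz i); move: di h; set a := p i _; set b := p i _; set c := p i _; lra.
Qed.

Let lc_nbhs_nbhs (x : L) (A : set L) : nbhs x A -> nbhs x (nbhs^~ A).
Proof.
move=> [n [p [e [e0 Pp pA]]]]; exists n, p, e; split => // y xy.
have [m [q [d [d0 Pq qB]]]] := lc_ball_nbhs Pp e0 xy.
by exists m, q, d; split => //; exact: subset_trans pA.
Qed.

HB.instance Definition _ := Nbhs_isNbhsTopological.Build L
  lc_nbhs_filter lc_nbhs_singleton lc_nbhs_nbhs.

Let lc_add_continuous : continuous (fun x : L * L => x.1 + x.2).
Proof.
move=> [x y] A [n [p [e [e0 Pp pA]]]].
have e20 : 0 < e / 2 by lra.
exists (lc_ball p (e / 2) x, lc_ball p (e / 2) y).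
  by split; exists n, p, (e / 2); split.
move=> [x' y'] [/= hx hy]; apply: pA => i /=.
have := snD (p i) (x' - x) (y' - y); rewrite addrACA -opprD.
by move: (hx i) (hy i); set a := p i _; set b := p i _; set c := p i _; lra.
Qed.

Let lc_scale_continuous : continuous (fun z : R[i]^o * L => z.1 *: z.2).
Proof.
move=> [k x] A [n [p [e [e0 Pp pA]]]].
pose M := \big[Num.max/1]_(i < n) p i x.
have M1 : 1 <= M by rewrite /M; exact: bigmax_ge_id.
have pM i : p i x <= M by rewrite /M; exact: le_bigmax_cond.
pose N := cnorm k + 1.
have N0 : 0 < N by have := cnorm_ge0 k; rewrite /N; lra.
pose d1 := Num.min 1 (e / 2 / M).
have d10 : 0 < d1 by rewrite /d1 lt_min ltr01 !divr_gt0 //; lra.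
pose d2 := e / 2 / N.
have d20 : 0 < d2 by rewrite /d2 !divr_gt0.
exists ([set l : R[i]^o | cnorm (l - k) < d1], lc_ball p d2 x).
  split; last by exists n, p, d2; split.
  exists (d1%:C%C) => /=; first by rewrite ltcR.
  by move=> l /=; rewrite distrC -cnormE ltcR.
move=> [l y] [/= hl hy]; apply: pA => i /=.
have -> : l *: y - k *: x = l *: (y - x) + (l - k) *: x.
  by rewrite scalerBr scalerBl addrA subrK.
apply: le_lt_trans (snD _ _ _) _; rewrite !snZ.
have lN : cnorm l < N.
  have := cnormD (l - k) k; rewrite subrK => h.
  have d11 : d1 <= 1 by rewrite /d1 ge_min lexx.
  by apply: (le_lt_trans h); rewrite /N addrC ltrD2l (lt_le_trans hl).
have h1 : cnorm l * p i (y - x) <= e / 2.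
  have -> : e / 2 = N * d2 by rewrite /d2 [RHS]mulrC divfK // gt_eqF.
  by apply: ler_pM => //; [exact: cnorm_ge0|exact: sn_ge0|exact: ltW|exact/ltW/hy].
have h2 : cnorm (l - k) * p i x < e / 2.
  have d1M : d1 <= e / 2 / M by rewrite /d1 ge_min lexx orbT.
  have M0 : 0 < M by lra.
  have -> : e / 2 = (e / 2 / M) * M by rewrite divfK // gt_eqF.
  apply: (@le_lt_trans _ _ (cnorm (l - k) * M)).
    by rewrite ler_wpM2l // cnorm_ge0.
  by rewrite ltr_pM2r // (lt_le_trans hl).
by rewrite [ltRHS]splitr; exact: ler_ltD.
Qed.

Let lc_locally_convex :
  exists2 B : set_system L, (forall b, b \in B -> convex_set b) & basis B.
Proof.
exists [set A | exists n (p : 'I_n -> seminorm E) e x,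
    [/\ 0 < e, forall i, P (p i) & A = lc_ball p e x]].
  move=> A /set_mem[n [p [e [x [e0 _ ->]]]]]; apply/convex_setW.
  move=> y z; rewrite !inE => hy hz k k0 k1; rewrite inE => i.
  rewrite [X in p i X](_ : _ = k%:num *: (y - x) + (1 - k%:num) *: (z - x)); last first.
    rewrite -[X in X - x]/(k%:num *: y + (1 - k%:num) *: z) !scalerBr addrACA -opprD -scalerDl; congr (_ - _).
    by rewrite addrC subrK scale1r.
  have kr : (complex.Re k%:num)%:C%C = k%:num.
    by move: k0; case: (k%:num) => a b; rewrite ltcE /= => /andP[/eqP -> _].
  have r0 : 0 < complex.Re k%:num by rewrite -ltcR kr.
  have r1 : complex.Re k%:num < 1 by rewrite -ltcR kr.
  have -> : 1 - k%:num = (1 - complex.Re k%:num)%:C%C by rewrite rmorphB /= kr.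
  rewrite -kr.
  apply: le_lt_trans (snD _ _ _) _; rewrite !snZ /= !expr0n /= !addr0 !sqrtr_sqr.
  rewrite !gtr0_norm ?subr_gt0 //.
  move: (hy i) (hz i) r0 r1; rewrite /=.
  set a := p i _; set b := p i _; set c := complex.Re _; nra.
split.
  move=> A [n [p [e [x [e0 Pp ->]]]]]; rewrite openE => y xy.
  exact: lc_ball_nbhs.
move=> x A [n [p [e [e0 Pp pA]]]].
exists (lc_ball p e x) => //; split; last exact: lc_ball_center.
by exists n, p, e, x.
Qed.

HB.instance Definition _ := PreTopologicalLmod_isTvs.Build R[i] L
  lc_add_continuous lc_scale_continuous lc_locally_convex.

HB.instance Definition _ :=
  PreTopologicalNmodule_isTopologicalNmodule.Build L lc_add_continuous.
HB.instance Definition _ :=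
  TopologicalNmodule_isTopologicalLmodule.Build R[i] L lc_scale_continuous.
HB.instance Definition _ := Uniform_isTvs.Build R[i] L lc_locally_convex.

End LcSpace.

Section TvsProperties.
Context {R : realType}.

Definition absorbs (E : tvsType R[i]) (U B : set E) :=
  exists2 r : R, 0 < r &
    forall a : R[i], r <= cnorm a -> B `<=` [set a *: x | x in U].

Definition tvs_bounded (E : tvsType R[i]) (B : set E) :=
  forall U : set E, nbhs 0 U -> absorbs U B.

Definition abs_convex (E : tvsType R[i]) (U : set E) :=
  convex_set U /\ forall (a : R[i]) x, cnorm a <= 1 -> U x -> U (a *: x).

Definition bornivorous (E : tvsType R[i]) (U : set E) :=
  forall B : set E, tvs_bounded B -> absorbs U B.

Definition bornological (E : tvsType R[i]) :=
  forall U : set E, abs_convex U -> bornivorous U -> nbhs 0 U.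

Definition barrel (E : tvsType R[i]) (U : set E) :=
  [/\ abs_convex U, closed U & forall x, absorbs U [set x]].

Definition barrelled (E : tvsType R[i]) :=
  forall U : set E, barrel U -> nbhs 0 U.

(* [precompact B] means that the closure of [B] is compact. *)
Definition montel (E : tvsType R[i]) :=
  [/\ hausdorff_space E, barrelled E &
      forall B : set E, tvs_bounded B -> precompact B].

Definition has_fundamental_bounded (E : tvsType R[i]) :=
  exists B : nat -> set E, (forall n, tvs_bounded (B n)) /\
    forall A : set E, tvs_bounded A -> exists n, A `<=` B n.

(* Sets of linear forms; the members of an equicontinuous set belong to the
   topological dual. *)
Definition equicontinuous_forms (E : tvsType R[i])
    (M : set {linear E -> R[i]^o}) :=
  equicontinuous M (fun f => f : E -> R[i]^o).

(* bounded for the strong topology of the dual *)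
Definition strongly_bounded (E : tvsType R[i])
    (M : set {linear E -> R[i]^o}) :=
  forall B : set E, tvs_bounded B ->
    exists c : R, forall f x, M f -> B x -> cnorm (f x) <= c.

Definition DF_space (E : tvsType R[i]) :=
  has_fundamental_bounded E /\
  forall M : nat -> set {linear E -> R[i]^o},
    (forall n, equicontinuous_forms (M n)) ->
    strongly_bounded (\bigcup_n M n) ->
    equicontinuous_forms (\bigcup_n M n).

End TvsProperties.

Definition induced_topology (S T : topologicalType) (f : S -> T) :=
  forall A : set S, open A <-> open (A : set (initial_topology f)).

(* [B] is the image of a metric space under a topological embedding. *)
Definition metrizable_set (R : realType) (E : topologicalType) (B : set E) :=
  exists (M : metricType R) (f : M -> E),
    [/\ injective f, range f = B & induced_topology f].

Record submod (R : realType) (F : lmodType R[i]) := Submod {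
  submod_set :> set F;
  submod0 : submod_set 0;
  submodD : forall x y, submod_set x -> submod_set y -> submod_set (x + y);
  submodZ : forall a x, submod_set x -> submod_set (a *: x) }.

Section Subspace.
Context {R : realType} {F : lmodType R[i]} (W : submod F).

Definition submod_pred : {pred F} := [pred x | x \in (W : set F)].

Let submod_pred_closed : submod_closed submod_pred.
Proof.
split; first exact: mem_set (submod0 W).
move=> a x y /set_mem Wx /set_mem Wy; apply: (mem_set (A := W)).
by apply: submodD => //; exact: submodZ.
Qed.

HB.instance Definition _ := GRing.isSubmodClosed.Build R[i] F submod_pred
  submod_pred_closed.

Record subsp : Type := Subsp { subval : F; subvalP : subval \in submod_pred }.

HB.instance Definition _ := [isSub for subval].
HB.instance Definition _ := [Choice of subsp by <:].
HB.instance Definition _ := [SubChoice_isSubLmodule of subsp by <:].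

Lemma subsp_in (x : subsp) : submod_set W (subval x).
Proof. exact: set_mem (subvalP x). Qed.

Definition to_subsp x (Wx : submod_set W x) : subsp := @Subsp x (mem_set Wx).

End Subspace.

Definition subsp_incl (R : realType) (F : lmodType R[i]) (W1 W2 : submod F)
  (W12 : W1 `<=` W2) (x : subsp W1) : subsp W2 := to_subsp (W12 _ (subsp_in x)).

Record weight (R : realType) (X : Type) (G : set X) := Weight {
  wfun :> X -> R;
  wfun_gt0 : forall z, G z -> 0 < wfun z }.

(* The sequence is indexed from [0]: [wseq k] is the (k+1)-st weight. *)
Record weight_seq (R : realType) (X : Type) (G : set X) := WeightSeq {
  wseq :> nat -> weight R G;
  wseq_decr : forall k z, G z -> wseq k.+1 z <= wseq k z }.

Section WeightedSpaces.
Context {R : realType} {X : Type} {G : set X}.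
Local Notation F := (X -> R[i]^o).
Implicit Types (A : submod F) (v : weight R G) (f : F).

Definition wvalues v f : set R := [set v z * cnorm (f z) | z in G].

Definition pnorm v f : R := sup (wvalues v f).

Let wvalues0 v : has_ubound (wvalues v 0).
Proof.
exists 0 => _ [z Gz <-].
by rewrite [cnorm _]ComplexField.Normc.normc0 mulr0.
Qed.

Let wvaluesD v f g : has_ubound (wvalues v f) -> has_ubound (wvalues v g) ->
  has_ubound (wvalues v (f + g)).
Proof.
move=> [a fa] [b gb]; exists (a + b) => _ [z Gz <-].
have v0 := wfun_gt0 v Gz.
apply: (le_trans (y := v z * cnorm (f z) + v z * cnorm (g z))).
  by rewrite -mulrDr ler_pM2l // cnormD.
by apply: lerD; [apply: fa|apply: gb]; exists z.
Qed.

Let wvaluesZ v a f : has_ubound (wvalues v f) ->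
  has_ubound (wvalues v (a *: f)).
Proof.
move=> [b fb]; exists (cnorm a * b) => _ [z Gz <-].
rewrite [cnorm (_ z)]ComplexField.Normc.normcM mulrCA.
by apply: ler_wpM2l; [exact: cnorm_ge0|apply: fb; exists z].
Qed.

(* the f in A with p_v(f) < oo for all v in W *)
Program Definition hull_submod A (W : set (weight R G)) : submod F :=
  @Submod R F [set f | submod_set A f /\
                       forall v, W v -> has_ubound (wvalues v f)] _ _ _.
Next Obligation. by move=> A W; split; [exact: submod0|]. Qed.
Next Obligation.
move=> A W f g [Af fW] [Ag gW]; split; first exact: submodD.
by move=> v Wv; apply: wvaluesD; [exact: fW|exact: gW].
Qed.
Next Obligation.
move=> A W a f [Af fW]; split; first exact: submodZ.
by move=> v Wv; apply: wvaluesZ; exact: fW.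
Qed.

Let wvalues_ge0 v f x : wvalues v f x -> 0 <= x.
Proof.
by move=> [z Gz <-]; rewrite mulr_ge0 ?cnorm_ge0 // ltW // wfun_gt0.
Qed.

Let pnorm_le v f b : 0 <= b ->
  (forall z, G z -> v z * cnorm (f z) <= b) -> pnorm v f <= b.
Proof.
move=> b0 fb; rewrite /pnorm; have [->|/set0P ne] := eqVneq (wvalues v f) set0.
  by rewrite sup0.
by apply: ge_sup => // _ [z Gz <-]; exact: fb.
Qed.

Let pnorm_ub v f z : has_ubound (wvalues v f) -> G z ->
  v z * cnorm (f z) <= pnorm v f.
Proof. by move=> fb Gz; apply: ub_le_sup => //; exists z. Qed.

Let pnorm_ge0 v f : 0 <= pnorm v f.
Proof.
rewrite /pnorm; have [[[x fx] fb]|] := pselect (has_sup (wvalues v f)).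
  by apply: le_trans (wvalues_ge0 fx) _; exact: ub_le_sup.
by move=> /sup_out ->.
Qed.

Let pnormD v f g : has_ubound (wvalues v f) -> has_ubound (wvalues v g) ->
  pnorm v (f + g) <= pnorm v f + pnorm v g.
Proof.
move=> fb gb; apply: pnorm_le => [|z Gz]; first by rewrite addr_ge0 ?pnorm_ge0.
apply: (le_trans (y := v z * cnorm (f z) + v z * cnorm (g z))).
  by rewrite -mulrDr ler_pM2l ?wfun_gt0 // cnormD.
by apply: lerD; exact: pnorm_ub.
Qed.

Let pnormZ_le v a f : has_ubound (wvalues v f) ->
  pnorm v (a *: f) <= cnorm a * pnorm v f.
Proof.
move=> fb; apply: pnorm_le => [|z Gz].
  by rewrite mulr_ge0 ?pnorm_ge0 ?cnorm_ge0.
rewrite [cnorm (_ z)]ComplexField.Normc.normcM mulrCA.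
by apply: ler_wpM2l; [exact: cnorm_ge0|exact: pnorm_ub].
Qed.

Let pnormZ v a f : has_ubound (wvalues v f) ->
  pnorm v (a *: f) = cnorm a * pnorm v f.
Proof.
move=> fb; apply/le_anti; rewrite pnormZ_le //=.
have [->|a0] := eqVneq a 0.
  by rewrite ComplexField.Normc.normc0 mul0r pnorm_ge0.
have na0 : 0 < cnorm a.
  rewrite lt_neqAle cnorm_ge0 andbT eq_sym.
  by apply: contra a0 => /eqP/ComplexField.Normc.eq0_normc ->.
rewrite mulrC -ler_pdivlMr // mulrC -ComplexField.Normc.normcV.
rewrite -[X in pnorm v X <= _](scalerK a0); apply: pnormZ_le; exact: wvaluesZ.
Qed.

Program Definition psn A (W : set (weight R G)) v (Wv : W v) :
  seminorm (subsp (hull_submod A W)) :=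
  @Seminorm R _ (fun h => pnorm v (subval h)) _ _.
Next Obligation.
move=> A W v Wv f g; have [_ fb] := subsp_in f; have [_ gb] := subsp_in g.
by apply: pnormD; [exact: fb|exact: gb].
Qed.
Next Obligation.
by move=> A W v Wv a f; have [_ fb] := subsp_in f; apply: pnormZ; exact: fb.
Qed.

Definition hull A (W : set (weight R G)) : tvsType R[i] :=
  lc_space [set p | exists v (Wv : W v), p = psn A Wv].

Definition wspace A v : tvsType R[i] := hull A [set v].

Variable V : weight_seq R G.

Definition step A k : tvsType R[i] := wspace A (V k).

Let step_mono A k l : (k <= l)%N ->
  hull_submod A [set V k] `<=` hull_submod A [set V l].
Proof.
move=> kl f [Af fk]; split => // _ ->.
have [b kb] := fk _ erefl; exists b => _ [z Gz <-].
apply: le_trans (kb _ (ex_intro2 _ _ z Gz erefl)).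
rewrite ler_wpM2r ?cnorm_ge0 //.
elim: l kl => [|l IH]; first by rewrite leqn0 => /eqP ->.
by rewrite leq_eqVlt => /orP[/eqP ->|/IH]//; apply: le_trans; exact: wseq_decr.
Qed.

Program Definition ind_submod A : submod F :=
  @Submod R F (\bigcup_k hull_submod A [set V k]) _ _ _.
Next Obligation. by move=> A; exists 0%N => //; exact: submod0. Qed.
Next Obligation.
move=> A f g [k _ fk] [l _ gl]; exists (maxn k l) => //.
by apply: submodD; [exact: (step_mono (leq_maxl k l))|
  exact: (step_mono (leq_maxr k l))].
Qed.
Next Obligation.
by move=> A a f [k _ fk]; exists k => //; exact: submodZ.
Qed.

Lemma step_sub A k : hull_submod A [set V k] `<=` ind_submod A.
Proof. by move=> f fk; exists k. Qed.

Definition step_incl A k : step A k -> subsp (ind_submod A) :=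
  subsp_incl (@step_sub A k).

(* The finest locally convex topology making the inclusions of the steps
   continuous: its continuous seminorms are those which are continuous on
   every step. *)
Definition ind_lim A : tvsType R[i] :=
  lc_space [set q : seminorm (subsp (ind_submod A)) |
    forall k, continuous (fun f : step A k => q (step_incl f))].

Definition dominated : set (weight R G) :=
  [set v | forall k, exists2 c : R, 0 < c & forall z, G z -> v z <= c * V k z].

Lemma ind_submod_hull A (W : set (weight R G)) : W `<=` dominated ->
  ind_submod A `<=` hull_submod A W.
Proof.
move=> Wd f [k _ [Af fk]]; split => // v /Wd/(_ k)[c c0 vc].
have [b kb] := fk _ erefl; exists (c * b) => _ [z Gz <-].
apply: (le_trans (y := c * (V k z * cnorm (f z)))).
  by rewrite mulrA ler_wpM2r ?cnorm_ge0 // vc.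
by rewrite ler_pM2l //; apply: kb; exists z.
Qed.

Lemma ind_submodS (A B : submod F) : A `<=` B -> ind_submod A `<=` ind_submod B.
Proof. by move=> AB f [k _ [Af fk]]; exists k => //; split => //; exact: AB. Qed.

End WeightedSpaces.

(* A function on an open set [D] is represented by its extension by [0].  For
   [D] open, [holo_fun D] is the space of holomorphic functions on [D]:
   [differentiable] is Frechet differentiability over [R[i]]. *)
Section FunctionSpaces.
Context {R : realType} {X : normedModType R[i]} {G : set X}.
Local Notation F := (X -> R[i]^o).

Program Definition cont_fun (D : set X) : submod F :=
  @Submod R F [set f | {within D, continuous f} /\ forall z, ~ D z -> f z = 0]
    _ _ _.
Next Obligation.
by move=> D; split => // ; apply: continuous_subspaceT; exact: cst_continuous.
Qed.
Next Obligation.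
move=> D f g [cf f0] [cg g0]; split; last first.
  by move=> z Dz; rewrite fctE f0 // g0 // addr0.
by move=> z; apply: continuousD; [exact: cf|exact: cg].
Qed.
Next Obligation.
move=> D a f [cf f0]; split; last first.
  by move=> z Dz; rewrite fctE f0 // scaler0.
by move=> z; apply: cvgZ; [exact: cvg_cst|exact: cf].
Qed.

Program Definition holo_fun (D : set X) : submod F :=
  @Submod R F [set f | (forall z, D z -> differentiable f z) /\
                       forall z, ~ D z -> f z = 0] _ _ _.
Next Obligation.
by move=> D; split => // z Dz; exact: differentiable_cst.
Qed.
Next Obligation.
move=> D f g [cf f0] [cg g0]; split; last first.
  by move=> z Dz; rewrite fctE f0 // g0 // addr0.
by move=> z Dz; apply: differentiableD; [exact: cf|exact: cg].
Qed.
Next Obligation.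
move=> D a f [cf f0]; split; last first.
  by move=> z Dz; rewrite fctE f0 // scaler0.
by move=> z Dz; apply: differentiableZ; exact: cf.
Qed.

Lemma holo_cont : holo_fun G `<=` cont_fun G.
Proof.
move=> f [df f0]; split => //; apply/continuous_in_subspaceT => z /set_mem Gz.
exact: differentiable_continuous (df z Gz).
Qed.

Variable V : weight_seq R G.

Definition Vbar : set (weight R G) :=
  dominated V `&` [set v | {within G, continuous (v : X -> R)}].

Definition VC : tvsType R[i] := ind_lim V (cont_fun G).
Definition VH : tvsType R[i] := ind_lim V (holo_fun G).
Definition HVbar : tvsType R[i] := hull (holo_fun G) Vbar.

(* The two canonical inclusions.  The second one is always onto, so that
   VH(G) = HVbar(G) holds topologically iff the topology of [VH] is the one
   induced by [HVbar]. *)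
Definition VH_to_VC : VH -> VC := subsp_incl (ind_submodS (@holo_cont)).
Definition VH_to_HVbar : VH -> HVbar :=
  subsp_incl (ind_submod_hull (@subIsetl _ (dominated V) _)).

End FunctionSpaces.

Arguments VH_to_VC {R X G} V.
Arguments VH_to_HVbar {R X G} V.

(* [x n] is the (n+1)-st term of the sequence. *)
Program Definition all_seq (R : realType) : submod (nat -> R[i]^o) :=
  @Submod R (nat -> R[i]^o) setT _ _ _.
Next Obligation. by []. Qed.
Next Obligation. by []. Qed.
Next Obligation. by []. Qed.

Definition K_infty (R : realType) (Lam : weight_seq R [set: nat]) :
  tvsType R[i] := hull (all_seq R) (dominated Lam).

Section Domain.
Context {R : realType}.
Implicit Types z w : R[i].

(* the principal argument of [z != 0], with values in ]- pi, pi] *)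
Definition Arg z : R :=
  let t := acos (complex.Re z / cnorm z) in
  if 0 <= complex.Im z then t else - t.

Definition G1 : set (R[i]^o) :=
  [set z | 1 / 2 < cnorm z < 1 /\ 0 < Arg z < pi].

Definition dist_compl (z : R[i]^o) : R := inf [set cnorm (z - w) | w in ~` G1].

Lemma Re_le_cnorm z : `|complex.Re z| <= cnorm z.
Proof.
case: z => a b /=; rewrite -sqrtr_sqr ler_wsqrtr // lerDl sqr_ge0 //.
Qed.

Lemma Im_le_cnorm z : `|complex.Im z| <= cnorm z.
Proof.
case: z => a b /=; rewrite -sqrtr_sqr ler_wsqrtr // lerDr sqr_ge0 //.
Qed.

Lemma Re_ratio z : 0 < cnorm z -> -1 <= complex.Re z / cnorm z <= 1.
Proof.
move=> z0; rewrite -ler_norml normrM normfV (gtr0_norm z0).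
by rewrite ler_pdivrMr // mul1r Re_le_cnorm.
Qed.

Lemma Arg_itv z : 0 < cnorm z -> (0 < Arg z < pi) <-> 0 < complex.Im z.
Proof.
move=> z0; have rz := Re_ratio z0; rewrite /Arg; split.
  case: ifP => [I0|_]; last first.
    by move=> /andP[+ _]; rewrite oppr_gt0 ltNge acos_ge0.
  move=> h; rewrite lt_neqAle I0 andbT; apply/eqP => I00; move: h z0 {rz}.
  case: z I0 I00 => a b /= _ <-; rewrite expr0n addr0 sqrtr_sqr normr_gt0 => + a0.
  have [a0'|a0'] := ltP 0 a.
    by rewrite gtr0_norm // divff // acos1 ltxx.
  rewrite ler0_norm // invrN mulrN divff // acosN1 ltxx andbF //.
move=> I0; rewrite (ltW I0).
have lt1 : `|complex.Re z / cnorm z| < 1.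
  rewrite normrM normfV (gtr0_norm z0) ltr_pdivrMr // mul1r.
  case: z I0 {z0 rz} => a b /= b0; rewrite -sqrtr_sqr ltr_sqrt.
    by rewrite ltrDl exprn_gt0.
  by rewrite ltr_wpDl ?sqr_ge0 // exprn_gt0.
move: lt1; rewrite ltr_norml => /andP[h1 h2].
by rewrite acos_gt0 ?h2 ?(ltW h1) // acos_ltpi ?h1 ?(ltW h2).
Qed.

Lemma G1E z : G1 z <-> 1 / 2 < cnorm z < 1 /\ 0 < complex.Im z.
Proof.
split=> -[h Az]; split => //; have z0 : 0 < cnorm z by lra.
  exact/(Arg_itv z0).
exact/(Arg_itv z0).
Qed.

Lemma dist_compl_itv z : G1 z -> 0 < dist_compl z <= 1.
Proof.
move=> /G1E[/andP[z1 z2] I0].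
have Rez : (~` G1) (complex.Re z +i* 0)%C by move=> /G1E[_]; rewrite ltxx.
apply/andP; split; last first.
  apply: (le_trans (y := cnorm (z - (complex.Re z +i* 0)%C))).
    apply: ge_inf; last by exists (complex.Re z +i* 0)%C.
    by exists 0 => _ [w _ <-]; exact: cnorm_ge0.
  have := Im_le_cnorm z; case: z z1 z2 I0 {Rez} => a b /= _ z2 b0.
  by rewrite subrr expr0n add0r subr0 sqrtr_sqr; lra.
pose e := Num.min (Num.min (cnorm z - 1 / 2) (1 - cnorm z)) (complex.Im z).
have e0 : 0 < e by rewrite /e !lt_min I0 andbT; apply/andP; split; lra.
apply: (lt_le_trans e0); apply: lb_le_inf.
  by exists (cnorm (z - (complex.Re z +i* 0)%C)), (complex.Re z +i* 0)%C.
move=> _ [w Gw <-]; rewrite leNgt; apply/negP; rewrite /e !lt_min.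
move=> /andP[/andP[h1 h2] h3]; apply: Gw; apply/G1E.
have := cnormD (z - w) w; rewrite subrK => h4.
have := cnormD (w - z) z; rewrite subrK -[cnorm (w - z)]cnormN opprB => h5.
have h6 := Im_le_cnorm (z - w).
have h7 : `|complex.Im z - complex.Im w| <= cnorm (z - w).
  by move: h6; case: (z) (w) => a b [c d].
split; first by lra.
by move: h7; rewrite ler_norml; lra.
Qed.

End Domain.

Section AngularWeights.
Context {R : realType}.

Definition theta (n : nat) : R := (2 * n%:R)^-1.
Definition Ileft (n : nat) : R := theta n - (2 ^+ 5 * n%:R ^+ 2)^-1.
Definition Iright (n : nat) : R := theta n + (2 ^+ 5 * n%:R ^+ 2)^-1.
Definition ppt (n : nat) : R := theta n + (2 ^+ 4 * n%:R ^+ 2)^-1.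

Definition affine_on (f : R -> R) (a b : R) :=
  exists c m, forall t, a <= t <= b -> f t = c + m * t.

(* [Lam k n] stands for $\lambda_{n+1,k+1}$ and [w k] for $\hat w_{k+1}$. *)
Record angular_weights (Lam : weight_seq R [set: nat]) (w : nat -> R -> R) :
  Prop := AngularWeights {
  angular_gt0 : forall k t, 0 <= t <= pi -> 0 < w k t;
  angular_I : forall k n t, Ileft n.+1 <= t <= Iright n.+1 -> w k t = Lam k n;
  angular_p : forall k n, w k (ppt n.+1) = 1;
  angular_0 : forall k, w k 0 = 1;
  angular_pi : forall k, w k pi = 1;
  angular_affr : forall k n, affine_on (w k) (Iright n.+1) (ppt n.+1);
  angular_affl : forall k n, affine_on (w k) (ppt n.+2) (Ileft n.+1);
  angular_affpi : forall k, affine_on (w k) (ppt 1) pi }.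

Lemma affine_le (f g : R -> R) a b t : affine_on f a b -> affine_on g a b ->
  a <= t <= b -> f a <= g a -> f b <= g b -> f t <= g t.
Proof.
move=> [c [m fE]] [c' [m' gE]] abt.
rewrite !fE ?gE //; try lra.
case/andP: abt => at_ tb ha hb; have [q0|/ltW q0] := leP m m'.
  have : 0 <= (m' - m) * (t - a) by rewrite mulr_ge0 // subr_ge0.
  by rewrite mulrBl !mulrBr; lra.
have : 0 <= (m - m') * (b - t) by rewrite mulr_ge0 // subr_ge0.
by rewrite mulrBl !mulrBr; lra.
Qed.

Lemma angular_decr Lam w : angular_weights Lam w ->
  forall k t, 0 < t <= pi -> w k.+1 t <= w k t.
Proof.
move=> [_ wI wp _ wpi affr affl affpi] k t /andP[t0 tpi].
have [tp|tp] := leP (ppt 1) t.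
  by apply: (affine_le (affpi _) (affpi _)); rewrite ?tp ?wp ?wpi.
have ex : exists m, ppt m.+1 <= t.
  exists (Num.bound t^-1); set m := Num.bound t^-1.
  have tm : t^-1 < m%:R by apply: archi_boundP; rewrite invr_ge0 ltW.
  have m0 : 0 < m%:R :> R by apply: lt_trans tm; rewrite invr_gt0.
  have m1 : 1 <= m.+1%:R :> R by rewrite ler1n.
  have mt : m.+1%:R^-1 <= t.
    rewrite invf_ple ?posrE // ?ltr0n //; apply: (le_trans (ltW tm)).
    by rewrite ler_nat.
  apply: le_trans mt; rewrite /ppt /theta.
  set x : R := m.+1%:R in m1 *; have x0 : 0 < x by lra.
  have -> : (2 * x)^-1 + (2 ^+ 4 * x ^+ 2)^-1 = (x^-1) * (2^-1 + 16^-1 * x^-1).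
    by field; rewrite gt_eqF.
  have xV1 : x^-1 <= 1 by rewrite invf_le1.
  rewrite ler_piMr ?invr_ge0 ?(ltW x0) //.
  by move: xV1; set y := x^-1; lra.
have [[|n] tn nmin] := ex_minnP ex; first by move: tn; rewrite leNgt tp.
have tn' : t < ppt n.+1 by rewrite ltNge; apply/negP => /nmin; rewrite ltnn.
have q0 : 0 < (2 ^+ 5 * n.+1%:R ^+ 2)^-1 :> R.
  by rewrite invr_gt0 mulr_gt0 ?exprn_gt0 // ltr0n.
have lr : Ileft n.+1 <= Iright n.+1 by rewrite lerD2l; move: q0; set q := (_)^-1; lra.
have decr : Lam k.+1 n <= Lam k n by exact: wseq_decr.
have wl j : w j (Ileft n.+1) = Lam j n by apply: wI; rewrite lexx.
have wr j : w j (Iright n.+1) = Lam j n by apply: wI; rewrite lexx andbT.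
have [tl|tl] := leP t (Ileft n.+1).
  by apply: (affine_le (affl _ n) (affl _ n)); rewrite ?tn ?wp ?wl.
have [tr|tr] := leP t (Iright n.+1).
  by rewrite !(wI _ n) ?tr ?(ltW tl).
by apply: (affine_le (affr _ n) (affr _ n)); rewrite ?(ltW tr) ?(ltW tn') ?wp ?wr.
Qed.


End AngularWeights.

Section ConcreteWeights.
Context {R : realType}.

(* meaningful for [k >= 1] only *)
Definition u_weight (k : nat) (z : R[i]^o) (t : R) : R :=
  let a := - ((k%:R - 1) / (2 * k%:R)) in
  if k%:R + 1 <= t then (1 + t) `^ a
  else if t <= k%:R then (1 + (dist_compl z)^-1 + t) `^ a
  else (k%:R + 1 - t) * (1 + (dist_compl z)^-1 + k%:R) `^ a +
       (t - k%:R) * (1 + (k%:R + 1)) `^ a.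

Let e (k : nat) : R := (k%:R - 1) / (2 * k%:R).

Let e_ge0 k : 0 <= e k.+1.
Proof.
have k0 : 0 <= k%:R :> R by [].
by rewrite /e divr_ge0 // subr_ge0 ler1n.
Qed.

Let e_incr k : e k.+1 <= e k.+2.
Proof.
have k0 : 0 <= k%:R :> R by [].
rewrite /e -(natr1 k.+1) -(natr1 k) addrK !addrK.
move: k0; set x : R := k%:R => k0.
rewrite ler_pdivrMr; last by lra.
rewrite mulrAC ler_pdivlMr; last by lra.
by nra.
Qed.

Let powRN_base k x y : 1 <= x -> x <= y -> y `^ (- e k.+1) <= x `^ (- e k.+1).
Proof.
move=> x1 xy; have x0 : 0 < x by lra.
have y0 : 0 < y by lra.
rewrite !powRN lef_pV2 ?posrE ?powR_gt0 //.
by apply: ge0_ler_powR; rewrite ?nnegrE ?(ltW x0) ?(ltW y0).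
Qed.

Let powRN_exp k x : 1 <= x -> x `^ (- e k.+2) <= x `^ (- e k.+1).
Proof. by move=> x1; rewrite ler_powR // lerN2. Qed.

Lemma u_weight_gt0 k z t : G1 z -> 0 <= t -> 0 < u_weight k z t.
Proof.
move=> /dist_compl_itv/andP[d0 _] t0; have dV : 0 < (dist_compl z)^-1.
  by rewrite invr_gt0.
have k0 : 0 <= k%:R :> R by [].
rewrite /u_weight; case: (leP (k%:R + 1) t) => [h|h]; first by rewrite powR_gt0; lra.
case: (leP t k%:R) => h'; first by rewrite powR_gt0; lra.
apply: ltr_wpDl; rewrite ?mulr_ge0 ?powR_ge0 //; first by lra.
by rewrite mulr_gt0 ?powR_gt0 //; lra.
Qed.

Lemma u_weight_decr k z t : G1 z -> 0 <= t -> u_weight k.+2 z t <= u_weight k.+1 z t.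
Proof.
move=> /dist_compl_itv/andP[d0 d1] t0.
have k0 : 0 <= k%:R :> R by [].
have D1 : 1 <= (dist_compl z)^-1 by rewrite invf_ge1.
rewrite /u_weight -/(e k.+1) -/(e k.+2); set D := (dist_compl z)^-1 in D1 *.
rewrite -(natr1 k.+1); set K : R := k.+1%:R.
have K0 : 0 <= K by [].
case: (leP (K + 1 + 1) t) => h1.
  case: (leP (K + 1) t) => h2; last by lra.
  by apply: powRN_exp; lra.
case: (leP t (K + 1)) => h2; case: (leP (K + 1) t) => h3; try lra.
- apply: le_trans (powRN_exp _ _) _; first by lra.
  by apply: powRN_base; lra.
- case: (leP t K) => h4.
    by apply: powRN_exp; lra.
  apply: (le_trans (powRN_exp _ _)); first by lra.
  apply: (le_trans (y := (1 + D + K) `^ (- e k.+1))).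
    by apply: powRN_base; lra.
  have AB : (1 + D + K) `^ (- e k.+1) <= (1 + (K + 1)) `^ (- e k.+1).
    by apply: powRN_base; lra.
  move: AB; set A := _ `^ _; set B := _ `^ _ => AB.
  have : 0 <= (t - K) * (B - A) by rewrite mulr_ge0 // subr_ge0 // ltW.
  by rewrite mulrBr !mulrBl mulrDl; lra.
- apply: (le_trans (y := (1 + (K + 1 + 1)) `^ (- e k.+2))); last first.
    apply: (le_trans (powRN_exp _ _)); first by lra.
    by apply: powRN_base; lra.
  have AB : (1 + D + (K + 1)) `^ (- e k.+2) <= (1 + (K + 1 + 1)) `^ (- e k.+2).
    by apply: powRN_base; lra.
  move: AB; set A := _ `^ _; set B := _ `^ _ => AB.
  have : 0 <= (K + 1 + 1 - t) * (B - A) by rewrite mulr_ge0 // subr_ge0 // ltW.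
  by rewrite mulrBr !mulrBl !mulrDl; lra.
Qed.

Definition G12 : set (R[i]^o * R[i]^o) := [set z | G1 z.1].

Section Weights.
Context {Lam : weight_seq R [set: nat]} {w : nat -> R -> R}.
Hypothesis hw : angular_weights Lam w.

Program Definition v_weight (k : nat) : weight R G12 :=
  @Weight R _ G12 (fun z => w k (Arg z.1) * u_weight k.+1 z.1 (cnorm z.2)) _.
Next Obligation.
move=> k [z1 z2] /= Gz; rewrite mulr_gt0 ?u_weight_gt0 ?cnorm_ge0 //.
by apply: (angular_gt0 hw); case: Gz => _ /andP[/ltW -> /ltW ->].
Qed.

Program Definition v_seq : weight_seq R G12 := @WeightSeq R _ G12 v_weight _.
Next Obligation.
move=> k [z1 z2] /= Gz; have Az : 0 < Arg z1 < pi := Gz.2.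
apply: ler_pM.
- by apply/ltW/(angular_gt0 hw); case/andP: Az => /ltW -> /ltW ->.
- by apply/ltW; rewrite u_weight_gt0 ?cnorm_ge0.
- by apply: (angular_decr hw); case/andP: Az => -> /ltW ->.
- by rewrite u_weight_decr ?cnorm_ge0.
Qed.

End Weights.

End ConcreteWeights.

(* Main.v *)
(* The peaks [f_j = 2 z1^j], evaluated at the points
   [z_n = (i (1 - 1 / (n + 4)), 0)] of [G], separate the topologies.

   Every [f] in [HV(G)] is bounded on the [z_n], by a constant times its norm in
   [Hv_k(G)]: for [t = |z2| > k + 1] the weight [v_k(., z2)] is bounded below up
   to the boundary point [i], and a Cauchy estimate in the variable [z2] carries
   this bound to [z2 = 0].  The same estimate applied to a suitable continuous
   weight dominated by all [v_k] shows that [sup_n |f(z_n)|] is bounded on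
   bounded subsets of [HVbar(G)].  Thus [f |-> sup_n |f(z_n)|] is a continuous
   seminorm on [VH(G)], it is at least [1] on all [f_j], and its unit ball is
   bornivorous in [HVbar(G)].

   On the other hand [f_j] tends to [0] in [HVbar(G)] and in [VC(G)]: it is small
   on compact subsets of [G1]; for [|z2| <= k] the weight [v_k] is small near
   the boundary of [G1]; and for large [|z2|] the weight [v_2] is small.  In
   [VC(G)], unlike in [VH(G)], one may cut [f_j] into the two corresponding
   pieces.  In [VH(G)] the bounded sequence [f_j] has no cluster point, and the
   evaluations at the [z_n] are strongly bounded but not equicontinuous on
   [HVbar(G)]. *)
Require Import Defs.
From HB Require Import structures.
From mathcomp Require Import all_boot all_order all_algebra.
From mathcomp Require Import all_classical all_reals all_analysis.
From mathcomp Require Import complex.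
From mathcomp Require Import ring lra.
Import Order.TTheory GRing.Theory Num.Theory.
Import numFieldNormedType.Exports.
Local Open Scope classical_set_scope.
Local Open Scope ring_scope.

Set Implicit Arguments.
Unset Strict Implicit.
Unset Printing Implicit Defensive.

(** * Goursat and a Cauchy estimate *)

Section Segment.
Context {R : realType}.
Implicit Types h k : R -> R.

Definition seg_int h (a b : R) : R := (\int[lebesgue_measure]_(t in `[a, b]) h t)%R.

Lemma seg_integrable h a b : continuous h ->
  lebesgue_measure.-integrable `[a, b]%classic (EFin \o h).
Proof.
move=> ch; apply: continuous_compact_integrable; first exact: segment_compact.
exact: continuous_subspaceT.
Qed.

Lemma seg_int_split h a m b : continuous h -> a <= m -> m <= b ->
  seg_int h a b = seg_int h a m + seg_int h m b.
Proof.
move=> ch am mb; apply/eqP; rewrite addrC -subr_eq; apply/eqP.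
rewrite /seg_int Rintegral_itvB ?bnd_simp //; last exact: seg_integrable.
rewrite Rintegral_itv_obnd_cbnd //.
apply: integrableS (seg_integrable m b ch) => //.
exact: subset_itv_oc_cc.
Qed.

Lemma seg_intD h k a b : continuous h -> continuous k ->
  seg_int (fun t => h t + k t) a b = seg_int h a b + seg_int k a b.
Proof.
move=> ch ck; rewrite /seg_int RintegralD //.
- exact: (seg_integrable _ _ ch).
- exact: (seg_integrable _ _ ck).
Qed.

Lemma seg_int_ub h a b c : continuous h -> a <= b ->
  (forall t, a <= t <= b -> h t <= c) -> seg_int h a b <= c * (b - a).
Proof.
move=> ch ab hc.
have -> : c * (b - a) = seg_int (fun=> c) a b.
  rewrite /seg_int Rintegral_cst //= lebesgue_measure_itv /= lte_fin.
  case: ltP => [_ //|ba]; have -> : a = b by lra.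
  by rewrite subrr mulr0.
have ih := seg_integrable a b ch.
have ic : lebesgue_measure.-integrable `[a, b]%classic (EFin \o (fun _ : R => c)).
  by apply: seg_integrable => x; exact: cvg_cst.
apply: le_Rintegral => // t /=; rewrite in_itv /=; exact: hc.
Qed.

Lemma seg_int_lb h a b c : continuous h -> a <= b ->
  (forall t, a <= t <= b -> c <= h t) -> c * (b - a) <= seg_int h a b.
Proof.
move=> ch ab hc.
have -> : c * (b - a) = seg_int (fun=> c) a b.
  rewrite /seg_int Rintegral_cst //= lebesgue_measure_itv /= lte_fin.
  case: ltP => [_ //|ba]; have -> : a = b by lra.
  by rewrite subrr mulr0.
have ih := seg_integrable a b ch.
have ic : lebesgue_measure.-integrable `[a, b]%classic (EFin \o (fun _ : R => c)).
  by apply: seg_integrable => x; exact: cvg_cst.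
apply: le_Rintegral => // t /=; rewrite in_itv /=; exact: hc.
Qed.

End Segment.

Section Goursat.
Context {R : realType}.

(** Goursat's argument for an arbitrary additive function of rectangles. If the value is not 0, some
    quarter of each rectangle retains a quarter of the modulus, while the square of the
    half-perimeter is also divided by 4. The nested quarters shrink to a point at which the local
    bound fails. *)
Lemma goursat_bisection (Phi : R -> R -> R -> R -> R) a0 b0 c0 d0 :
  a0 <= b0 -> c0 <= d0 ->
  (forall a m b c d, a <= m -> m <= b -> c <= d ->
     Phi a b c d = Phi a m c d + Phi m b c d) ->
  (forall a b c m d, a <= b -> c <= m -> m <= d ->
     Phi a b c d = Phi a b c m + Phi a b m d) ->
  (forall x y e, a0 <= x <= b0 -> c0 <= y <= d0 -> 0 < e ->
     exists2 r, 0 < r & forall a b c d, a <= x <= b -> c <= y <= d ->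
       (b - a) + (d - c) < r ->
       `|Phi a b c d| <= e * ((b - a) + (d - c)) ^+ 2) ->
  Phi a0 b0 c0 d0 = 0.
Proof.
move=> ab0 cd0 Hx Hy Hloc; apply/eqP/negPn/negP => P0.
pose A (s : R * R * R * R) := s.1.1.1; pose B (s : R * R * R * R) := s.1.1.2.
pose C (s : R * R * R * R) := s.1.2; pose D (s : R * R * R * R) := s.2.
pose L s := (B s - A s) + (D s - C s).
pose P s := Phi (A s) (B s) (C s) (D s).
pose s0 := (a0, b0, c0, d0).
(* The summand 1 in the denominator covers a degenerate rectangle with [L s0] = 0. *)
have [eta eta0 big0] : exists2 eta, 0 < eta & eta * (L s0) ^+ 2 < `|P s0|.
  exists (`|P s0| / ((L s0) ^+ 2 + 1)).
    by rewrite divr_gt0 ?normr_gt0 // ltr_wpDl // sqr_ge0.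
  rewrite mulrAC ltr_pdivrMr; last by rewrite ltr_wpDl // sqr_ge0.
  by rewrite ltr_pM2l ?normr_gt0 // ltrDl.
pose bad s := [/\ A s <= B s, C s <= D s & eta * (L s) ^+ 2 < `|P s|].
pose sub s s' := [/\ A s <= A s', B s' <= B s, C s <= C s', D s' <= D s &
  L s' = L s / 2].
(* The implication is kept inside the existential so that [choice] yields a total map; on rectangles
   that are not bad its value is arbitrary. *)
have step s : exists s', bad s -> bad s' /\ sub s s'.
  have [bs|nb] := pselect (bad s); last by exists s.
  case: s bs => [[[a b] c] d] [/= ab cd big].
  rewrite /A /B /C /D /L /P /= in ab cd big *.
  pose m := (a + b) / 2; pose n := (c + d) / 2.
  have [am mb] : a <= m /\ m <= b by rewrite /m; split; lra.
  have [cn nd] : c <= n /\ n <= d by rewrite /n; split; lra.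
  pose lim := eta * (((b - a) + (d - c)) / 2) ^+ 2.
  have E : Phi a b c d = Phi a m c n + Phi a m n d + (Phi m b c n + Phi m b n d).
    by rewrite (Hx a m) // (Hy a m c n) // (Hy m b c n).
  have limE : eta * (b - a + (d - c)) ^+ 2 = lim * 4 by rewrite /lim; field.
  have [h1|h1] := ltP lim `|Phi a m c n|.
    exists (a, m, c, n) => _; rewrite /bad /sub /A /B /C /D /L /P /=.
    have -> : m - a + (n - c) = ((b - a) + (d - c)) / 2 by rewrite /m /n; field.
    by do !split.
  have [h2|h2] := ltP lim `|Phi a m n d|.
    exists (a, m, n, d) => _; rewrite /bad /sub /A /B /C /D /L /P /=.
    have -> : m - a + (d - n) = ((b - a) + (d - c)) / 2 by rewrite /m /n; field.
    by do !split.
  have [h3|h3] := ltP lim `|Phi m b c n|.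
    exists (m, b, c, n) => _; rewrite /bad /sub /A /B /C /D /L /P /=.
    have -> : b - m + (n - c) = ((b - a) + (d - c)) / 2 by rewrite /m /n; field.
    by do !split.
  have [h4|h4] := ltP lim `|Phi m b n d|.
    exists (m, b, n, d) => _; rewrite /bad /sub /A /B /C /D /L /P /=.
    have -> : b - m + (d - n) = ((b - a) + (d - c)) / 2 by rewrite /m /n; field.
    by do !split.
  exfalso; move: big; rewrite E limE => big.
  have := ler_normD (Phi a m c n + Phi a m n d) (Phi m b c n + Phi m b n d).
  have := ler_normD (Phi a m c n) (Phi a m n d).
  have := ler_normD (Phi m b c n) (Phi m b n d).
  lra.
have {step} [next nextP] := choice step.
pose s n := iter n next s0.
have bs n : bad (s n) by elim: n => [|n /nextP[]].
have ss n : sub (s n) (s n.+1) by exact: (nextP _ (bs n)).2.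
have mono m n : [/\ A (s m) <= A (s (m + n)%N), B (s (m + n)%N) <= B (s m),
    C (s m) <= C (s (m + n)%N) & D (s (m + n)%N) <= D (s m)].
  elim: n => [|n [h1 h2 h3 h4]]; first by rewrite addn0.
  by rewrite addnS; have [k1 k2 k3 k4 _] := ss (m + n)%N; split;
    apply: le_trans; eassumption.
have AB m n : A (s m) <= B (s n).
  have [h1 _ _ _] := mono m n; have [_ h2 _ _] := mono n m.
  have [h3 _ _] := bs (m + n)%N; rewrite addnC in h2.
  exact: le_trans h1 (le_trans h3 h2).
have CD m n : C (s m) <= D (s n).
  have [_ _ h1 _] := mono m n; have [_ _ _ h2] := mono n m.
  have [_ h3 _] := bs (m + n)%N; rewrite addnC in h2.
  exact: le_trans h1 (le_trans h3 h2).
(* The suprema of the left and of the lower ends give a point common to all the rectangles. *)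
pose x := sup (range (fun n => A (s n))); pose y := sup (range (fun n => C (s n))).
have xP n : A (s n) <= x <= B (s n).
  apply/andP; split.
    by apply: ub_le_sup; [exists (B (s 0%N)) => _ [k _ <-]|exists n].
  by apply: ge_sup => [|_ [k _ <-]]; first by exists (A (s 0%N)), 0%N.
have yP n : C (s n) <= y <= D (s n).
  apply/andP; split.
    by apply: ub_le_sup; [exists (D (s 0%N)) => _ [k _ <-]|exists n].
  by apply: ge_sup => [|_ [k _ <-]]; first by exists (C (s 0%N)), 0%N.
have [r r0 rP] := Hloc x y _ (xP 0%N) (yP 0%N) eta0.
have Ln n : L (s n) = L s0 / 2 ^+ n.
  elim: n => [|n IH]; first by rewrite expr0 divr1.
  by have [_ _ _ _ ->] := ss n; rewrite IH exprS invfM mulrA mulrAC.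
have L0 : 0 <= L s0 by rewrite /L addr_ge0 ?subr_ge0.
have [n nP] : exists n, L (s n) < r.
  exists (Num.bound (L s0 / r)); rewrite Ln ltr_pdivrMr ?exprn_gt0 //.
  rewrite mulrC -ltr_pdivrMr //; apply: lt_trans (archi_boundP _) _.
    by rewrite divr_ge0 // ltW.
  by rewrite -natrX ltr_nat ltn_expl.
have [_ _ big] := bs n.
by have := rP _ _ _ _ (xP n) (yP n) nP; rewrite leNgt big.
Qed.

End Goursat.

(** * Complex derivatives in epsilon-delta form *)

Section ComplexPlane.
Context {R : realType}.
Local Notation C := R[i].
Implicit Types (f g : C -> C) (z h : C).

Lemma normr_cnorm (z : C) : `|z| = (cnorm z)%:C%C. Proof. by rewrite cnormE. Qed.

Lemma cnormM (x y : C) : cnorm (x * y) = cnorm x * cnorm y.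
Proof. exact: ComplexField.Normc.normcM. Qed.

Lemma cnormV (x : C) : cnorm x^-1 = (cnorm x)^-1.
Proof. exact: ComplexField.Normc.normcV. Qed.

Lemma cnorm_gt0 (z : C) : z != 0 -> 0 < cnorm z.
Proof.
move=> z0; rewrite lt_neqAle cnorm_ge0 andbT eq_sym.
by apply: contra z0 => /eqP/ComplexField.Normc.eq0_normc ->.
Qed.

Lemma cnorm_real (x : R) : cnorm x%:C%C = `|x|.
Proof. by rewrite /= expr0n addr0 sqrtr_sqr. Qed.

Lemma cnorm_le_ReIm (x y : R) : cnorm (x +i* y)%C <= `|x| + `|y|.
Proof.
have -> : (x +i* y)%C = (x%:C + (0 +i* y))%C by congr (Complex _ _); rewrite ?addr0 ?add0r.
apply: (le_trans (cnormD _ _)); apply: lerD; first by rewrite cnorm_real.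
by rewrite /= expr0n add0r sqrtr_sqr.
Qed.

(** The bound is not strict and is multiplied out, so that h = 0 is harmless; radii and tolerances
    are real, whereas [differentiable] over [R[i]] works with positive elements of [R[i]]. *)
Definition has_cderiv f z (a : C) := forall e : R, 0 < e ->
  exists2 r : R, 0 < r & forall h, cnorm h < r ->
    cnorm (f (z + h) - f z - a * h) <= e * cnorm h.

Definition ccont f z := forall e : R, 0 < e ->
  exists2 r : R, 0 < r & forall h, cnorm h < r -> cnorm (f (z + h) - f z) <= e.

Lemma has_cderiv_ccont f z a : has_cderiv f z a -> ccont f z.
Proof.
move=> fz e e0; have [r r0 rP] := fz 1 ltr01.
pose K := cnorm a + 1; have K0 : 0 < K by have := cnorm_ge0 a; rewrite /K; lra.
exists (Num.min r (e / K)); first by rewrite lt_min r0 divr_gt0.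
move=> h; rewrite lt_min => /andP[hr he].
have := cnormD (f (z + h) - f z - a * h) (a * h); rewrite subrK cnormM => k1.
apply: (le_trans k1).
have {}k1 := rP h hr; move: he; rewrite ltr_pdivlMr // /K mulrDr mulr1 => he.
by move: k1 he; rewrite mul1r [cnorm h * _]mulrC; lra.
Qed.

Lemma differentiable_cderiv (f : C^o -> C^o) (z : C^o) :
  differentiable f z -> exists a, has_cderiv f z a.
Proof.
move=> /derivable1_diffP/cvg_ex[/= a fa]; exists a => e e0.
have eC : 0 < e%:C%C :> C by rewrite ltcR.
move/cvgrPdist_lt : fa => /(_ _ eC)[/= r /= r0 rP].
(* A positive element of [R[i]] is real, because the order compares only numbers with equal
   imaginary parts. *)
have rE : (complex.Re r)%:C%C = r.
  by move: r0; case: (r) => x y; rewrite ltcE /= => /andP[/eqP -> _].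
exists (complex.Re r); first by rewrite -ltcR rE.
move=> h hr; have [->|h0] := eqVneq h 0.
  by rewrite addr0 mulr0 !subrr [cnorm 0]ComplexField.Normc.normc0 mulr0.
have /= := rP h; rewrite sub0r normrN normr_cnorm -rE ltcR => /(_ hr h0).
rewrite normr_cnorm ltcR [h *: 1]mulr1 [h + z]addrC => k.
rewrite -ler_pdivrMr ?cnorm_gt0 // -cnormV -cnormM -cnormN.
apply: le_trans (ltW k); rewrite le_eqVlt; apply/orP; left; apply/eqP.
congr cnorm; rewrite -[h^-1 *: _]/(h^-1 * _) mulrBl mulfK //; ring.
Qed.

End ComplexPlane.

(** * Contour integrals around rectangles *)

Section Flux.
Context {R : realType}.
Local Notation C := R[i].
Local Notation cRe := complex.Re.
Local Notation cIm := complex.Im.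
Implicit Types (f g : C -> C) (z h : C).

(* The imaginary part of the contour integral of [g] around the boundary of
   [a, b] x [c, d]. *)
Definition flux g (a b c d : R) : R :=
  seg_int (fun y => cRe (g (b +i* y)%C) - cRe (g (a +i* y)%C)) c d -
  seg_int (fun x => cIm (g (x +i* d)%C) - cIm (g (x +i* c)%C)) a b.

Lemma ccont_Re_vert g x : (forall z, ccont g z) ->
  continuous (fun y : R => cRe (g (x +i* y)%C)).
Proof.
move=> cg y; apply/cvgrPdist_le => /= e e0.
have [r r0 rP] := cg (x +i* y)%C e e0.
exists r => //= t; rewrite /ball_ /= distrC => ht.
have := rP (0 +i* (t - y))%C; have -> : ((x +i* y) + (0 +i* (t - y)))%C = (x +i* t)%C.
  by congr (Complex _ _); ring.
have -> : cnorm (0 +i* (t - y))%C = `|t - y| by rewrite /= expr0n add0r sqrtr_sqr.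
move=> /(_ ht); apply: le_trans; apply: le_trans (Re_le_cnorm _).
by rewrite distrC; case: (g (x +i* t)%C) (g (x +i* y)%C) => ? ? [].
Qed.

Lemma ccont_Im_hor g y : (forall z, ccont g z) ->
  continuous (fun x : R => cIm (g (x +i* y)%C)).
Proof.
move=> cg x; apply/cvgrPdist_le => /= e e0.
have [r r0 rP] := cg (x +i* y)%C e e0.
exists r => //= t; rewrite /ball_ /= distrC => ht.
have := rP (t - x)%:C%C; have -> : ((x +i* y) + (t - x)%:C)%C = (t +i* y)%C.
  by congr (Complex _ _); ring.
rewrite cnorm_real.
move=> /(_ ht); apply: le_trans; apply: le_trans (Im_le_cnorm _).
by rewrite distrC; case: (g (t +i* y)%C) (g (x +i* y)%C) => ? ? [].
Qed.

Lemma flux_splitx g a m b c d : (forall z, ccont g z) ->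
  a <= m -> m <= b -> c <= d -> flux g a b c d = flux g a m c d + flux g m b c d.
Proof.
move=> cg am mb cd.
have cv x := @ccont_Re_vert g x cg; have ch y := @ccont_Im_hor g y cg.
have cvB u v : continuous (fun y => cRe (g (v +i* y)%C) - cRe (g (u +i* y)%C)).
  by move=> y; apply: cvgB; [exact: (cv v)|exact: (cv u)].
have chB u v : continuous (fun x => cIm (g (x +i* v)%C) - cIm (g (x +i* u)%C)).
  by move=> x; apply: cvgB; [exact: (ch v)|exact: (ch u)].
rewrite /flux (seg_int_split (m := m) (chB c d)) //.
rewrite (_ : seg_int (fun y => cRe (g (b +i* y)%C) - cRe (g (a +i* y)%C)) c d =
  seg_int (fun y => cRe (g (m +i* y)%C) - cRe (g (a +i* y)%C)) c d +
  seg_int (fun y => cRe (g (b +i* y)%C) - cRe (g (m +i* y)%C)) c d).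
  by ring.
rewrite -(seg_intD _ _ (cvB a m) (cvB m b)); congr seg_int; apply: funext => y.
by ring.
Qed.

Lemma flux_splity g a b c m d : (forall z, ccont g z) ->
  a <= b -> c <= m -> m <= d -> flux g a b c d = flux g a b c m + flux g a b m d.
Proof.
move=> cg ab cm md.
have cv x := @ccont_Re_vert g x cg; have ch y := @ccont_Im_hor g y cg.
have cvB u v : continuous (fun y => cRe (g (v +i* y)%C) - cRe (g (u +i* y)%C)).
  by move=> y; apply: cvgB; [exact: (cv v)|exact: (cv u)].
have chB u v : continuous (fun x => cIm (g (x +i* v)%C) - cIm (g (x +i* u)%C)).
  by move=> x; apply: cvgB; [exact: (ch v)|exact: (ch u)].
rewrite /flux (seg_int_split (m := m) (cvB a b)) //.
rewrite (_ : seg_int (fun x => cIm (g (x +i* d)%C) - cIm (g (x +i* c)%C)) a b =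
  seg_int (fun x => cIm (g (x +i* m)%C) - cIm (g (x +i* c)%C)) a b +
  seg_int (fun x => cIm (g (x +i* d)%C) - cIm (g (x +i* m)%C)) a b).
  by ring.
rewrite -(seg_intD _ _ (chB c m) (chB m d)); congr seg_int; apply: funext => y.
by ring.
Qed.

Lemma ReB (z w : C) : cRe (z - w) = cRe z - cRe w.
Proof. by case: z w => ? ? []. Qed.

Lemma ImB (z w : C) : cIm (z - w) = cIm z - cIm w.
Proof. by case: z w => ? ? []. Qed.

Lemma flux_bounds g a b c d (u l u' l' : R) : (forall z, ccont g z) ->
  a <= b -> c <= d ->
  (forall y, c <= y <= d -> l <= cRe (g (b +i* y)%C) - cRe (g (a +i* y)%C) <= u) ->
  (forall x, a <= x <= b -> l' <= cIm (g (x +i* d)%C) - cIm (g (x +i* c)%C) <= u') ->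
  l * (d - c) - u' * (b - a) <= flux g a b c d <= u * (d - c) - l' * (b - a).
Proof.
move=> cg ab cd hy hx.
have cv x := @ccont_Re_vert g x cg; have ch y := @ccont_Im_hor g y cg.
have cvB : continuous (fun y => cRe (g (b +i* y)%C) - cRe (g (a +i* y)%C)).
  by move=> y; apply: cvgB; [exact: (cv b)|exact: (cv a)].
have chB : continuous (fun x => cIm (g (x +i* d)%C) - cIm (g (x +i* c)%C)).
  by move=> x; apply: cvgB; [exact: (ch d)|exact: (ch c)].
have hyl y (h : c <= y <= d) := proj1 (andP (hy y h)).
have hyu y (h : c <= y <= d) := proj2 (andP (hy y h)).
have hxl x (h : a <= x <= b) := proj1 (andP (hx x h)).
have hxu x (h : a <= x <= b) := proj2 (andP (hx x h)).
have k1 := seg_int_lb cvB cd hyl; have k2 := seg_int_ub cvB cd hyu.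
have k3 := seg_int_lb chB ab hxl; have k4 := seg_int_ub chB ab hxu.
by rewrite /flux; move: k1 k2 k3 k4; rewrite /=; lra.
Qed.

(** The affine part of g at a point, with slope k, contributes Re k (b - a) (d - c) to each of the
    two integrals in [flux], so it cancels. The remainder changes the integrands by at most e L,
    hence the flux by at most e L^2, as [goursat_bisection] demands. *)
Lemma flux_eq0 g a b c d : (forall z, ccont g z) -> a <= b -> c <= d ->
  (forall x y, a <= x <= b -> c <= y <= d ->
     exists k, has_cderiv g (x +i* y)%C k) ->
  flux g a b c d = 0.
Proof.
move=> cg ab cd dg; apply: goursat_bisection => //.
- by move=> *; exact: flux_splitx.
- by move=> *; exact: flux_splity.
move=> x y e xab ycd e0; have [k kP] := dg x y xab ycd.
have e20 : 0 < e / 2 by lra.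
have [r r0 rP] := kP _ e20; exists r => // a' b' c' d' xab' ycd'.
move: (a') (b') (c') (d') xab' ycd' => {ab cd xab ycd dg}{}a {}b {}c {}d.
move=> /andP[ax xb] /andP[cy yd]; set L := _ + _ => Lr.
have err u v : a <= u <= b -> c <= v <= d ->
    cnorm (g (u +i* v)%C - g (x +i* y)%C - k * ((u - x) +i* (v - y))%C) <= e / 2 * L.
  move=> uab vcd; have h1 := cnorm_le_ReIm (u - x) (v - y).
  have h2 : `|u - x| + `|v - y| <= L.
    rewrite /L; apply: lerD; rewrite ler_norml; lra.
  have -> : (u +i* v)%C = ((x +i* y) + ((u - x) +i* (v - y)))%C.
    by congr (Complex _ _); ring.
  apply: (le_trans (rP _ _)); first lra.
  by rewrite ler_pM2l //; lra.
(* Subtracting two expansions at (x, y) eliminates the value there and doubles the error, which is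
   why [rP] was taken for e / 2. *)
have err2 u v u' v' : a <= u <= b -> c <= v <= d -> a <= u' <= b -> c <= v' <= d ->
    cnorm (g (u +i* v)%C - g (u' +i* v')%C - k * ((u - u') +i* (v - v'))%C) <= e * L.
  move=> h1 h2 h3 h4; have k1 := err u v h1 h2; have k2 := err u' v' h3 h4.
  rewrite -cnormN in k2.
  have := cnormD (g (u +i* v)%C - g (x +i* y)%C - k * ((u - x) +i* (v - y))%C)
     (- (g (u' +i* v')%C - g (x +i* y)%C - k * ((u' - x) +i* (v' - y))%C)).
  have -> : (g (u +i* v)%C - g (x +i* y)%C - k * ((u - x) +i* (v - y))%C) -
     (g (u' +i* v')%C - g (x +i* y)%C - k * ((u' - x) +i* (v' - y))%C) =
     g (u +i* v)%C - g (u' +i* v')%C - k * ((u - u') +i* (v - v'))%C.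
    have -> : ((u - u') +i* (v - v'))%C = ((u - x) +i* (v - y))%C - ((u' - x) +i* (v' - y))%C.
      by congr (Complex _ _); ring.
    by ring.
  lra.
have aa : a <= a <= b by rewrite lexx; lra.
have bb : a <= b <= b by rewrite lexx; lra.
have cc : c <= c <= d by rewrite lexx; lra.
have dd : c <= d <= d by rewrite lexx; lra.
have ab : a <= b by lra.
have cd : c <= d by lra.
have hy v : c <= v <= d -> cRe k * (b - a) - e * L <=
    cRe (g (b +i* v)%C) - cRe (g (a +i* v)%C) <= cRe k * (b - a) + e * L.
  move=> hv; have := le_trans (Re_le_cnorm _) (err2 b v a v bb hv aa hv).
  rewrite !ReB subrr; have -> : cRe (k * ((b - a) +i* 0)%C) = cRe k * (b - a).
    by case: (k) => k1 k2 /=; ring.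
  by rewrite ler_norml; lra.
have hx u : a <= u <= b -> cRe k * (d - c) - e * L <=
    cIm (g (u +i* d)%C) - cIm (g (u +i* c)%C) <= cRe k * (d - c) + e * L.
  move=> hu; have := le_trans (Im_le_cnorm _) (err2 u d u c hu dd hu cc).
  rewrite !ImB subrr; have -> : cIm (k * (0 +i* (d - c))%C) = cRe k * (d - c).
    by case: (k) => k1 k2 /=; ring.
  by rewrite ler_norml; lra.
have /andP[k1 k2] := flux_bounds cg ab cd hy hx.
have LE : e * L ^+ 2 = e * L * (d - c) + e * L * (b - a) by rewrite /L; ring.
rewrite ler_norml LE; move: k1 k2.
move: (b - a) (d - c) (cRe k) (e * L) => X Y K E k1 k2.
by apply/andP; split; nra.
Qed.

End Flux.

(** * From vanishing contour integrals to a bound at the centre *)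

Section EntireBound.
Context {R : realType}.
Local Notation C := R[i].
Local Notation cRe := complex.Re.
Local Notation cIm := complex.Im.

(** The value [a] at 0 is meant to be the derivative of F there; this makes the quotient continuous
    on the whole plane. *)
Definition dquot (F : C -> C) (a z : C) : C :=
  if z == 0 then a else (F z - F 0) / z.

Lemma dquot_ccont0 F a : has_cderiv F 0 a -> ccont (dquot F a) 0.
Proof.
move=> Fa e e0; have [r r0 rP] := Fa e e0; exists r => // h hr.
rewrite add0r /dquot eqxx; case: eqVneq => [_|h0].
  by rewrite subrr [cnorm 0]ComplexField.Normc.normc0 ltW.
have -> : (F h - F 0) / h - a = (F h - F 0 - a * h) / h.
  by rewrite [RHS]mulrBl mulfK.
rewrite cnormM cnormV ler_pdivrMr ?cnorm_gt0 //.
by have := rP h hr; rewrite add0r.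
Qed.

Lemma dquot_cderiv (F : C^o -> C^o) a z : differentiable F (z : C^o) -> z != 0 ->
  exists k, has_cderiv (dquot F a) z k.
Proof.
move=> dF z0; pose q (w : C^o) : C^o := (F w - F 0) * w^-1.
have dq : differentiable q (z : C^o).
  apply: differentiableM.
    by apply: differentiableB => //; exact: differentiable_cst.
  by apply: differentiable_Rinv.
have [k kP] := differentiable_cderiv dq; exists k => e e0.
(* The radius [cnorm z] keeps z + h away from 0, the only point where [dquot] and [q] may differ. *)
have [r r0 rP] := kP e e0; exists (Num.min r (cnorm z)).
  by rewrite lt_min r0 cnorm_gt0.
move=> h; rewrite lt_min => /andP[hr hz]; rewrite /dquot (negPf z0).
case: eqVneq => [zh|_]; last exact: rP.
by move: hz; rewrite -(addKr z h) zh addr0 cnormN ltxx.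
Qed.

Lemma cnorm_Re_pos (x : C) : exists2 u : C, cnorm u = 1 & u * x = (cnorm x)%:C%C.
Proof.
have [->|x0] := eqVneq x 0.
  exists 1; first exact: ComplexField.Normc.normc1.
  by rewrite mulr0 [cnorm 0]ComplexField.Normc.normc0.
exists ((cnorm x)%:C%C / x); last by rewrite divfK.
by rewrite cnormM cnormV cnorm_real ger0_norm ?cnorm_ge0 // divff // gt_eqF // cnorm_gt0.
Qed.

(* Cauchy's formula on a square, in a crude form: with [F 0 > 0], the flux of
   [(F z - F 0) / z] vanishes, but that of [- F 0 / z] is at most [- 4 F 0]. *)
Lemma entire_bound (f : C^o -> C^o) (t M : R) : 0 < t ->
  (forall z : C^o, differentiable f z) ->
  (forall z : C, t <= cnorm z <= 2 * t -> cnorm (f z) <= M) ->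
  cnorm (f 0) <= 2 * M.
Proof.
move=> t0 df fM; have [u u1 uf] := cnorm_Re_pos (f 0).
set A := cnorm (f 0) in uf *.
pose F (z : C^o) : C^o := u * f z.
have dF (z : C^o) : differentiable F z by apply: differentiableZ.
have FM z : t <= cnorm z <= 2 * t -> cnorm (F z) <= M.
  by move=> /fM; rewrite /F cnormM u1 mul1r.
have [a aP] := differentiable_cderiv (dF 0).
pose g := dquot F a.
have dg z : z != 0 -> exists k, has_cderiv g z k by move=> z0; exact: dquot_cderiv.
have cg z : ccont g z.
  have [->|/dg[k]] := eqVneq z 0; first exact: dquot_ccont0.
  exact: has_cderiv_ccont.
have flux0 a' b c d : a' <= b -> c <= d ->
    (forall x y, a' <= x <= b -> c <= y <= d -> (x +i* y)%C != 0 :> C) ->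
    flux g a' b c d = 0.
  by move=> ab cd h; apply: flux_eq0 => // x y hx hy; apply: dg; exact: h.
(* At 0 only the continuity of [g] is at hand. The flux therefore reduces to that of a small square
   around 0, where |g| <= K bounds it by 8 K d. *)
have fluxt : flux g (- t) t (- t) t = 0.
  have [r r0 rP] := cg 0 1 ltr01.
  pose K := cnorm a + 1; have K1 : 1 <= K by have := cnorm_ge0 a; rewrite /K; lra.
  have gK z : cnorm z < r -> cnorm (g z) <= K.
    move=> /rP; rewrite add0r; have := cnormD (g z - g 0) (g 0); rewrite subrK.
    by rewrite {2 4}/g /dquot eqxx /K; lra.
  apply/eqP; rewrite -normr_eq0; apply/eqP/le_anti; rewrite normr_ge0 andbT.
  apply/ler_addgt0Pr => e e0; rewrite add0r.
  (* With d <= r / 3, points of the small square satisfy |x| + |y| <= 2 d < r, so that [gK]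
     applies. *)
  pose d := Num.min (Num.min t (r / 3)) (e / (8 * K)).
  have d0 : 0 < d by rewrite /d !lt_min t0 !divr_gt0 //; lra.
  have dt : d <= t by rewrite /d !ge_min lexx.
  have dr : d <= r / 3 by rewrite /d !ge_min lexx orbT.
  have de : d * (8 * K) <= e.
    by rewrite -ler_pdivlMr; [rewrite /d !ge_min lexx !orbT|lra].
  (* The large square is cut into the small one and four rectangles that avoid 0. *)
  have -> : flux g (- t) t (- t) t = flux g (- d) d (- d) d.
    have [td dl tt dt'] : [/\ - t <= - d, - d <= d, - t <= t & - d <= t] by split; lra.
    rewrite (flux_splitx cg td dt' tt) (flux_splitx cg dl dt tt).
    rewrite (flux_splity cg dl td dt') (flux_splity cg dl dl dt).
    rewrite (flux0 (- t) (- d)); [|lra|lra|]; last first.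
      by move=> x y hx hy; apply/eqP => -[x0 y0]; lra.
    rewrite (flux0 (- d) d (- t)); [|lra|lra|]; last first.
      by move=> x y hx hy; apply/eqP => -[x0 y0]; lra.
    rewrite (flux0 (- d) d d t); [|lra|lra|]; last first.
      by move=> x y hx hy; apply/eqP => -[x0 y0]; lra.
    rewrite (flux0 d t); [|lra|lra|]; last first.
      by move=> x y hx hy; apply/eqP => -[x0 y0]; lra.
    by rewrite !add0r !addr0.
  have gKd x y : - d <= x <= d -> - d <= y <= d -> cnorm (g (x +i* y)%C) <= K.
    move=> hx hy; apply: gK; apply: (le_lt_trans (cnorm_le_ReIm _ _)).
    have : `|x| <= d by rewrite ler_norml.
    have : `|y| <= d by rewrite ler_norml.
    by lra.
  have dd : - d <= d <= d by rewrite lexx; lra.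
  have dn : - d <= - d <= d by rewrite lexx; lra.
  have dl : - d <= d by lra.
  have hy y : - d <= y <= d -> - (2 * K) <= cRe (g (d +i* y)%C) - cRe (g (- d +i* y)%C) <= 2 * K.
    move=> hy; have := le_trans (Re_le_cnorm _) (gKd d y dd hy).
    have := le_trans (Re_le_cnorm _) (gKd (- d) y dn hy).
    by rewrite !ler_norml; lra.
  have hx x : - d <= x <= d -> - (2 * K) <= cIm (g (x +i* d)%C) - cIm (g (x +i* (- d))%C) <= 2 * K.
    move=> hx; have := le_trans (Im_le_cnorm _) (gKd x d hx dd).
    have := le_trans (Im_le_cnorm _) (gKd x (- d) hx dn).
    by rewrite !ler_norml; lra.
  have /andP[k1 k2] := flux_bounds cg dl dl hy hx.
  by rewrite ler_norml; move: k1 k2 de; rewrite !mulrA; lra.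
have gE z : z != 0 -> g z = F z / z - A%:C%C / z.
  by move=> z0; rewrite /g /dquot (negPf z0) mulrBl /F uf.
(* On the boundary of the square, t <= |z| <= 2 t, so |F z / z| <= M / t; the rest of [g] is the
   explicit term - A / z. *)
have key x y : `|x| <= t -> `|y| <= t -> (`|x| = t) \/ (`|y| = t) ->
   (- (M / t) - A * (x / (x ^+ 2 + y ^+ 2)) <= cRe (g (x +i* y)%C)
      <= M / t - A * (x / (x ^+ 2 + y ^+ 2))) /\
   (- (M / t) + A * (y / (x ^+ 2 + y ^+ 2)) <= cIm (g (x +i* y)%C)
      <= M / t + A * (y / (x ^+ 2 + y ^+ 2))).
  move=> xt yt xy; set z := (x +i* y)%C.
  have tz : t <= cnorm z.
    case: xy => <-; first by have := Re_le_cnorm z.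
    by have := Im_le_cnorm z.
  have z2 : cnorm z <= 2 * t by have := cnorm_le_ReIm x y; rewrite -/z; lra.
  have z0 : z != 0.
    by apply/eqP => z0; move: tz; rewrite z0 [cnorm 0]ComplexField.Normc.normc0; lra.
  have Fz : cnorm (F z / z) <= M / t.
    have hz : cnorm (F z) <= M by apply: FM; rewrite tz z2.
    have h0 := cnorm_ge0 (F z).
    rewrite cnormM cnormV; apply: ler_pM => //; first by rewrite invr_ge0 cnorm_ge0.
    by rewrite lef_pV2 // posrE; lra.
  have := le_trans (Re_le_cnorm _) Fz; have := le_trans (Im_le_cnorm _) Fz.
  rewrite !ler_norml gE // ReB ImB.
  have -> : A%:C%C / z = ((A * (x / (x ^+ 2 + y ^+ 2))) +i* (- (A * (y / (x ^+ 2 + y ^+ 2)))))%C.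
    by rewrite /z /=; apply/eqP; rewrite eq_complex /=; apply/andP; split; apply/eqP; ring.
  move=> /=; lra.
rewrite leNgt; apply/negP => AM.
have A0 : 0 <= A by exact: cnorm_ge0.
(* On a side of the square, x^2 + y^2 lies between t^2 and 2 t^2. *)
have frac (x y : R) : `|x| <= t -> y ^+ 2 = t ^+ 2 ->
    A / (2 * t) <= A * (t / (x ^+ 2 + y ^+ 2)) <= A / t.
  move=> xt ->; have x2 : x ^+ 2 <= t ^+ 2.
    by rewrite -(real_normK (num_real x)) ler_pXn2r ?nnegrE //; lra.
  have t2 : 0 < t ^+ 2 by rewrite exprn_gt0.
  have x20 := sqr_ge0 x; have s0 : 0 < x ^+ 2 + t ^+ 2 by lra.
  apply/andP; split; apply: ler_wpM2l => //.
    by rewrite ler_pdivlMr // mulrC ler_pdivrMr; [rewrite mulrCA -expr2; lra|lra].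
  by rewrite ler_pdivrMr // mulrC ler_pdivlMr // -expr2; lra.
have tt : - t <= t by lra.
have nt : `|t| = t by rewrite gtr0_norm.
have nnt : `|- t| = t by rewrite normrN.
have ntl : `|t| <= t by rewrite nt.
have nntl : `|- t| <= t by rewrite nnt.
set m := M / t; set q := A / (2 * t).
have hy y : - t <= y <= t -> - (2 * m) - 2 * (A / t)
    <= cRe (g (t +i* y)%C) - cRe (g (- t +i* y)%C) <= 2 * m - 2 * q.
  move=> hy; have yt : `|y| <= t by rewrite ler_norml.
  have [h1 _] := key t y ntl yt (or_introl nt).
  have [h2 _] := key (- t) y nntl yt (or_introl nnt).
  have h3 := frac y t yt erefl; rewrite addrC in h3.
  by move: h1 h2 h3; rewrite -/m -/q sqrrN mulNr mulrN; clear; lra.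
have hx x : - t <= x <= t -> - (2 * m) + 2 * q
    <= cIm (g (x +i* t)%C) - cIm (g (x +i* (- t))%C) <= 2 * m + 2 * (A / t).
  move=> hx; have xt : `|x| <= t by rewrite ler_norml.
  have [_ h1] := key x t xt ntl (or_intror nt).
  have [_ h2] := key x (- t) xt nntl (or_intror nnt).
  have h3 := frac x t xt erefl.
  by move: h1 h2 h3; rewrite -/m -/q sqrrN mulNr mulrN; clear; lra.
(* The upper bound for the flux equals 8 M - 4 A, which is negative if A > 2 M. *)
have /andP[_] := flux_bounds cg tt tt hy hx; rewrite fluxt.
have mt : m * t = M by rewrite /m divfK // gt_eqF.
have qt : q * t = A / 2 by rewrite /q; field; rewrite gt_eqF.
have -> : (2 * m - 2 * q) * (t - - t) - (- (2 * m) + 2 * q) * (t - - t) =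
    8 * (m * t) - 8 * (q * t) by ring.
by rewrite mt qt; lra.
Qed.

End EntireBound.

(** * Bounds for the weights *)

Section AngularBounds.
Context {R : realType} {Lam : weight_seq R [set: nat]} {w : nat -> R -> R}.
Hypothesis Lam_bounds : forall k n : nat, (n.+1%:R ^+ 2)^-1 <= Lam k n <= 1.
Hypothesis hw : angular_weights Lam w.

Lemma affine_on_cst (c a b : R) : affine_on (fun=> c) a b.
Proof. by exists c, 0 => t _; rewrite mul0r addr0. Qed.

Lemma pi_le4 : pi <= 4 :> R.
Proof. by have [/andP[_ h] _] := pihalf_02_cos_pihalf R; lra. Qed.

(** For t >= p_1 the weight is 1, and t <= pi <= 4 gives the factor 16. Between p_(n+1) and p_n the
    weight is piecewise affine with nodal values in [1 / n^2, 1], and t < p_n <= 1 / n. The lower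
    bound does not depend on k. *)
Lemma angular_bounds k t : 0 < t <= pi -> t ^+ 2 / 16 <= w k t <= 1.
Proof.
move=> /andP[t0 tpi]; have [_ wI wp _ wpi affr affl affpi] := hw.
have [tp|tp] := leP (ppt 1) t.
  have tt : ppt 1 <= t <= pi by rewrite tp tpi.
  apply/andP; split.
    apply: (@le_trans _ _ 1).
      by have := pi_le4; rewrite ler_pdivrMr // mul1r expr2; nra.
    by apply: (affine_le (affine_on_cst 1 _ _) (affpi k) tt); rewrite ?wp ?wpi.
  by apply: (affine_le (affpi k) (affine_on_cst 1 _ _) tt); rewrite ?wp ?wpi.
have ppt_le m : ppt m.+1 <= m.+1%:R^-1 :> R.
  have m1 : 1 <= m.+1%:R :> R by rewrite ler1n.
  rewrite /ppt /theta; set x : R := m.+1%:R in m1 *; have x0 : 0 < x by lra.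
  have -> : (2 * x)^-1 + (2 ^+ 4 * x ^+ 2)^-1 = (x^-1) * (2^-1 + 16^-1 * x^-1).
    by field; rewrite gt_eqF.
  have xV1 : x^-1 <= 1 by rewrite invf_le1.
  rewrite ler_piMr ?invr_ge0 ?(ltW x0) //.
  by move: xV1; set y := x^-1; lra.
have ex : exists m, ppt m.+1 <= t.
  exists (Num.bound t^-1); set m := Num.bound t^-1.
  have tm : t^-1 < m%:R by apply: archi_boundP; rewrite invr_ge0 ltW.
  have m0 : 0 < m%:R :> R by apply: lt_trans tm; rewrite invr_gt0.
  have m1 : 1 <= m.+1%:R :> R by rewrite ler1n.
  apply: (le_trans (ppt_le _)).
  rewrite invf_ple ?posrE // ?ltr0n //; apply: (le_trans (ltW tm)).
  by rewrite ler_nat.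
(* The least index is not 0 because t < [ppt 1]; writing it as [n.+1] places t in [[ppt n.+2],
   [ppt n.+1]). *)
have [[|n] tn nmin] := ex_minnP ex; first by move: tn; rewrite leNgt tp.
have tn' : t < ppt n.+1 by rewrite ltNge; apply/negP => /nmin; rewrite ltnn.
have q0 : 0 < (2 ^+ 5 * n.+1%:R ^+ 2)^-1 :> R.
  by rewrite invr_gt0 mulr_gt0 ?exprn_gt0 // ltr0n.
have lr : Ileft n.+1 <= Iright n.+1 :> R.
  by rewrite lerD2l; move: q0; set q := (_)^-1; lra.
have wl : w k (Ileft n.+1) = Lam k n by apply: wI; rewrite lexx.
have wr : w k (Iright n.+1) = Lam k n by apply: wI; rewrite lexx andbT.
have /andP[L0 L1] := Lam_bounds k n.
pose c : R := (n.+1%:R ^+ 2)^-1; rewrite -/c in L0.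
have c1 : c <= 1 by exact: le_trans L0 L1.
have tc : t ^+ 2 / 16 <= c.
  have h1 : t <= n.+1%:R^-1 by apply: le_trans (ppt_le n); exact: ltW.
  have h2 : t ^+ 2 <= c by rewrite /c -exprVn ler_pXn2r ?nnegrE ?invr_ge0 // ltW.
  by have := sqr_ge0 t; lra.
suff /andP[h1 h2] : c <= w k t <= 1 by rewrite h2 andbT; exact: le_trans h1.
have [tl|tl] := leP t (Ileft n.+1).
  have tt : ppt n.+2 <= t <= Ileft n.+1 by rewrite tn tl.
  apply/andP; split.
    by apply: (affine_le (affine_on_cst c _ _) (affl k n) tt); rewrite ?wp ?wl.
  by apply: (affine_le (affl k n) (affine_on_cst 1 _ _) tt); rewrite ?wp ?wl.
have [tr|tr] := leP t (Iright n.+1).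
  by rewrite (wI _ n) ?tr ?(ltW tl) // L0 L1.
have tt : Iright n.+1 <= t <= ppt n.+1 by rewrite (ltW tr) (ltW tn').
apply/andP; split.
  by apply: (affine_le (affine_on_cst c _ _) (affr k n) tt); rewrite ?wp ?wr.
by apply: (affine_le (affr k n) (affine_on_cst 1 _ _) tt); rewrite ?wp ?wr.
Qed.

End AngularBounds.

(** * The factor depending on the modulus of the second variable *)

Section UWeight.
Context {R : realType}.
Local Notation C := R[i].

Lemma sin_le (t : R) : 0 <= t -> sin t <= t.
Proof.
rewrite le_eqVlt => /predU1P[<-|t0]; first by rewrite sin0.
have [c _] := @MVT R sin cos 0 t t0 (fun x _ => is_derive_sin x)
  (continuous_subspaceT (@continuous_sin R)).
rewrite sin0 !subr0 => ->.
by rewrite ler_piMl ?cos_le1 // ltW.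
Qed.

(** Im z = |z| sin (Arg z) with |z| < 1, and sin t <= t. Bounds in terms of the argument thus pass
    to the imaginary part, which is continuous on the whole plane. *)
Lemma G1_Arg (z : C^o) : G1 z -> 0 < Arg z <= pi /\ complex.Im z <= Arg z.
Proof.
move=> Gz; have [/andP[z1 z2] /andP[h1 h2]] := Gz.
split; first by rewrite h1 ltW.
have /G1E[_ I0] := Gz; move: h1 h2.
have z0 : 0 < cnorm z by lra.
have rz := Re_ratio z0.
rewrite /Arg (ltW I0) => h1 h2; apply: le_trans (sin_le (ltW h1)).
rewrite sin_acos //.
have -> : 1 - (complex.Re z / cnorm z) ^+ 2 = (complex.Im z / cnorm z) ^+ 2.
  have : cnorm z ^+ 2 = complex.Re z ^+ 2 + complex.Im z ^+ 2.
    by case: (z) => a b /=; rewrite sqr_sqrtr // addr_ge0 ?sqr_ge0.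
  move: z0; move: (cnorm z) (complex.Re z) (complex.Im z) => r x y r0 E.
  apply/eqP; rewrite -(inj_eq (mulIf (expf_neq0 2 (lt0r_neq0 r0)))); apply/eqP.
  rewrite mulrBl mul1r !exprMn !exprVn !divfK ?expf_neq0 ?lt0r_neq0 // E; ring.
by rewrite sqrtr_sqr ger0_norm ?divr_ge0 ?(ltW I0) ?(ltW z0) // ler_pdivlMr //
  ler_piMr ?(ltW I0) ?(ltW z2).
Qed.

(** The radial projection z / |z| onto the unit circle lies outside [G1]. *)
Lemma dist_compl_le (z : C^o) : G1 z -> dist_compl z <= 1 - cnorm z.
Proof.
move=> [/andP[z1 z2] _]; have z0 : 0 < cnorm z by lra.
pose u : C^o := z / (cnorm z)%:C%C.
apply: (@le_trans _ _ (cnorm (z - u))).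
  apply: ge_inf; first by exists 0 => _ [x _ <-]; exact: cnorm_ge0.
  exists u => //; rewrite /G1 /=; case=> /andP[_].
  by rewrite cnormM cnormV cnorm_real gtr0_norm // divff ?gt_eqF // ltxx.
have -> : z - u = z * (1 - (cnorm z)^-1%:C%C).
  by rewrite /u mulrBr mulr1 rmorphV // unitfE gt_eqF.
rewrite cnormM -[1]/(1%:C%C) -rmorphB cnorm_real ltr0_norm; last first.
  by rewrite subr_lt0 invf_gt1.
by rewrite opprB mulrBr divff ?gt_eqF // mulr1.
Qed.

Let e (k : nat) : R := (k%:R - 1) / (2 * k%:R).

Let e_bounds k : 0 <= e k.+1 <= 1.
Proof.
have k0 : 0 <= k%:R :> R by [].
rewrite /e -(natr1 k) addrK; move: k0; set x : R := k%:R => x0.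
apply/andP; split; first by rewrite divr_ge0 //; lra.
by rewrite ler_pdivrMr; lra.
Qed.

Let e_lower k : 4^-1 <= e k.+2.
Proof.
have k0 : 0 <= k%:R :> R by [].
rewrite /e -(natr1 k.+1) -(natr1 k) addrK; move: k0; set x : R := k%:R => x0.
by rewrite ler_pdivlMr; lra.
Qed.

Lemma powR_opp_bounds k (x : R) : 1 <= x -> x^-1 <= x `^ (- e k.+1) <= 1.
Proof.
move=> x1; have /andP[e0 e1] := e_bounds k.
have x0 : 0 <= x by lra.
apply/andP; split; last by rewrite -(powRr0 x) ler_powR // oppr_le0.
by rewrite -powR_inv1 // ler_powR // lerN2.
Qed.

(** The exponent [e] vanishes for the first weight and is at least 1/4 from the second on, whence
    the index [k.+2]; x^(-1/4) <= eps amounts to x >= eps^-4. *)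
Lemma powR_opp_small k (x eps : R) : 0 < eps -> eps ^-4 <= x -> 1 <= x ->
  x `^ (- e k.+2) <= eps.
Proof.
move=> e0 ex x1; have x0 : 0 <= x by lra.
apply: (@le_trans _ _ (x `^ (- 4^-1))); first by rewrite ler_powR // lerN2 e_lower.
rewrite powRN -[leRHS]invrK lef_pV2 ?posrE ?powR_gt0 ?invr_gt0 //; last by lra.
have E : eps^-1 = (eps ^- 4) `^ 4^-1.
  rewrite -exprVn -powR_mulrn ?invr_ge0 ?(ltW e0) // -powRrM mulfV // powRr1 //.
  by rewrite invr_ge0 ltW.
by rewrite E; apply: ge0_ler_powR; rewrite ?nnegrE ?invr_ge0 // exprn_ge0 // ltW.
Qed.

Implicit Types (z : C^o) (t : R).

(** The exponents lie in [-1, 0], and the affine piece is a convex combination of two powers. The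
    lower bound degenerates at the boundary of [G1], in contrast to [u_weight_far_lb]. *)
Lemma u_weight_bounds k z t : G1 z -> 0 <= t ->
  (1 + (dist_compl z)^-1 + t)^-1 <= u_weight k.+1 z t <= 1.
Proof.
move=> /dist_compl_itv/andP[d0 d1] t0.
have k0 : 0 <= k%:R :> R by [].
have D1 : 1 <= (dist_compl z)^-1 by rewrite invf_ge1.
rewrite /u_weight -/(e k.+1); set D := (dist_compl z)^-1 in D1 *.
rewrite -(natr1 k); move: k0; set K : R := k%:R => k0.
case: (leP (K + 1 + 1) t) => h1.
  have /(powR_opp_bounds k)/andP[a b] : 1 <= 1 + t by lra.
  rewrite b andbT; apply: le_trans a.
  by rewrite lef_pV2 ?posrE; lra.
case: (leP t (K + 1)) => h2.
  by apply: powR_opp_bounds; lra.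
have /(powR_opp_bounds k)/andP[a b] : 1 <= 1 + D + (K + 1) by lra.
have /(powR_opp_bounds k)/andP[a' b'] : 1 <= 1 + (K + 1 + 1) by lra.
have c1 : (1 + D + t)^-1 <= (1 + D + (K + 1))^-1 by rewrite lef_pV2 ?posrE; lra.
have c2 : (1 + D + t)^-1 <= (1 + (K + 1 + 1))^-1 by rewrite lef_pV2 ?posrE; lra.
move: a b a' b' c1 c2 h1 h2; move: (_ `^ _) (_ `^ _) => X Y.
move: (1 + D + (K + 1))^-1 (1 + (K + 1 + 1))^-1 (1 + D + t)^-1 => p q s.
move=> *; apply/andP; split; nra.
Qed.

Lemma u_weight_far_lb k z t : G1 z -> k%:R + 2 <= t -> (1 + t)^-1 <= u_weight k.+1 z t.
Proof.
move=> _ h; have k0 : 0 <= k%:R :> R by [].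
have h1 : k.+1%:R + 1 <= t by rewrite -natr1; lra.
rewrite /u_weight h1 -/(e k.+1).
by have /(powR_opp_bounds k)/andP[] : 1 <= 1 + t by lra.
Qed.

Lemma u_weight_far_small (eps : R) : 0 < eps -> exists2 T : R, 0 <= T &
  forall z t, G1 z -> T <= t -> u_weight 2 z t <= eps.
Proof.
move=> e0; exists (eps ^-4 + 3); first by rewrite addr_ge0 ?invr_ge0 ?exprn_ge0 // ltW.
move=> z t _ h; have p0 : 0 <= eps ^-4 by rewrite invr_ge0 exprn_ge0 // ltW.
have h1 : 2%:R + 1 <= t by lra.
by rewrite /u_weight h1 -/(e 2); apply: powR_opp_small => //; lra.
Qed.

(** The term 1 / d(z1) >= eps^-4 alone makes the base of the power large enough, so one distance
    serves all k. *)
Lemma u_weight_bdry_small (eps : R) : 0 < eps -> exists2 d : R, 0 < d &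
  forall k z t, G1 z -> 0 <= t <= k%:R -> dist_compl z <= d -> u_weight k.+2 z t <= eps.
Proof.
move=> e0; have p0 : 0 < eps ^- 4 by rewrite invr_gt0 exprn_gt0.
exists (eps ^+ 4); first exact: exprn_gt0.
move=> k z t /dist_compl_itv/andP[d0 d1] /andP[t0 tk] dz.
have D1 : 1 <= (dist_compl z)^-1 by rewrite invf_ge1.
have De : eps ^- 4 <= (dist_compl z)^-1 by rewrite lef_pV2 // posrE exprn_gt0.
have h1 : k.+2%:R + 1 <= t = false.
  by apply/negbTE; rewrite -ltNge -!natr1; lra.
have h2 : t <= k.+2%:R by rewrite -!natr1; lra.
by rewrite /u_weight h1 h2 -/(e k.+2); apply: powR_opp_small => //; lra.
Qed.

End UWeight.

(** * Locally convex and weighted spaces *)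

Section LocalDiff.
Context {K : numFieldType} {V W : normedModType K}.

(** The differential is selected from the predicate [P] by choice. Functions that agree near x
    satisfy the same predicate, and by extensionality the same map is selected. This serves
    functions extended by 0 off an open set. *)
Lemma near_eq_differentiable (f g : V -> W) (x : V) :
  {near x, f =1 g} -> differentiable f x -> differentiable g x.
Proof.
pose P (h : V -> W) (df : {linear V -> W}) := continuous df /\
  forall y, h y = h (lim (nbhs x)) + df (y - lim (nbhs x))
    +o_(y \near x) (y - lim (nbhs x)).
have aux (f' g' : V -> W) : {near x, f' =1 g'} ->
    forall df, P f' df -> P g' df.
  move=> fg df [dc]; have gx : g' x = f' x by rewrite (nbhs_singleton fg).
  rewrite lim_id // => h; split=> //; rewrite lim_id //.
  have {h} : f' = cst (f' x) + (df \o center x) +o_ x (center x).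
    by rewrite funeqE.
  move=> /eqaddoP h.
  suff : g' = cst (g' x) + (df \o center x) +o_ x (center x) by rewrite funeqE.
  apply/eqaddoP => eps eps0.
  near=> y; have fgy : f' y = g' y by near: y; exact: fg.
  have : `|(f' - (cst (f' x) + df \o center x)) y| <= eps * `|center x y|.
    by near: y; exact: h.
  by rewrite !fctE /= gx fgy.
move=> fg.
have PE : P f = P g.
  apply: funext => df; apply: propext; split; apply: aux => //.
  by apply: filterS fg => y.
move=> /diffP[]; rewrite /diff -/(P f) => dc df.
have Pf : P f (get (P f)) by split.
apply/diffP; rewrite /diff -/(P g) -PE.
by have := Pf; rewrite {1}PE.
Unshelve. all: by end_near.
Qed.

End LocalDiff.

(** * Neighbourhoods and bounded sets in terms of seminorms *)

Section LcFacts.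
Context {R : realType} {E : lmodType R[i]} (P : set (seminorm E)).
Local Notation L := (lc_space P).
Implicit Types (p : seminorm E) (U B : set L).

Lemma nbhs0_lcP U : nbhs (0 : L) U -> exists n (p : 'I_n -> seminorm E) e,
  [/\ 0 < e, forall i, P (p i) & forall y, (forall i, p i y < e) -> U y].
Proof.
move=> [n [p [e [e0 Pp pU]]]]; exists n, p, e; split=> // y hy; apply: pU => i.
by rewrite subr0.
Qed.

Lemma lc_nbhs_ball p e (x : L) : P p -> 0 < e ->
  nbhs x ([set y : E | p (y - (x : E)) < e] : set L).
Proof.
by move=> Pp e0; exists 1%N, (fun=> p), e; split=> // y /(_ ord0).
Qed.

Lemma tvs_bounded_sn p B : P p -> tvs_bounded B ->
  exists c, forall x, B x -> p x <= c.
Proof.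
move=> Pp Bb; have := Bb _ (lc_nbhs_ball (0 : L) Pp ltr01).
case=> r r0 /(_ r%:C%C); rewrite cnorm_real gtr0_norm // => /(_ (lexx _)) h.
exists r => x /h [y /= hy <-]; rewrite subr0 in hy.
rewrite -[_ *: y]/((r%:C%C : R[i]) *: (y : E)) snZ cnorm_real gtr0_norm //.
by rewrite ler_piMr // ltW.
Qed.

Lemma sn_tvs_bounded B :
  (forall p, P p -> exists c, forall x, B x -> p x <= c) -> tvs_bounded (B : set L).
Proof.
move=> h U /nbhs0_lcP[n [p [e [e0 Pp pU]]]].
have /choice[c cP] i := h _ (Pp i).
(* This number exceeds every |c i| / e, so one radius serves all the seminorms. *)
pose r := 1 + \sum_i `|c i| / e.
have S0 : 0 <= \sum_i `|c i| / e by apply: sumr_ge0 => i _; rewrite divr_ge0 // ltW.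
exists r; first by rewrite /r; lra.
move=> a ra x Bx.
have a0 : 0 < cnorm a by apply: lt_le_trans ra; rewrite /r; lra.
have aN0 : a != 0.
  by apply/eqP => aE; move: a0; rewrite aE [cnorm 0]ComplexField.Normc.normc0 ltxx.
exists (a^-1 *: (x : E)); last by rewrite [LHS]scalerA mulfV // scale1r.
apply: pU => i; rewrite snZ cnormV mulrC ltr_pdivrMr //.
apply: (le_lt_trans (cP i x Bx)); apply: (le_lt_trans (ler_norm _)).
rewrite mulrC -ltr_pdivrMr //; apply: lt_le_trans ra.
rewrite /r (bigD1 i) //=.
have : 0 <= \sum_(j | j != i) `|c j| / e by apply: sumr_ge0 => j _; rewrite divr_ge0 // ltW.
by lra.
Qed.

End LcFacts.

Section WeightedFacts.
Context {R : realType} {X : Type} {G : set X}.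
Local Notation F := (X -> R[i]^o).
Implicit Types (A : submod F) (v : weight R G) (f : F).

Lemma pnorm_ub v f z : has_ubound (wvalues v f) -> G z ->
  v z * cnorm (f z) <= pnorm v f.
Proof. by move=> fb Gz; apply: ub_le_sup => //; exists z. Qed.

Lemma pnorm_le v f b : 0 <= b ->
  (forall z, G z -> v z * cnorm (f z) <= b) -> pnorm v f <= b.
Proof.
move=> b0 fb; rewrite /pnorm; have [->|/set0P ne] := eqVneq (wvalues v f) set0.
  by rewrite sup0.
by apply: ge_sup => // _ [z Gz <-]; exact: fb.
Qed.

Lemma wvalues_le v f b : (forall z, G z -> v z * cnorm (f z) <= b) ->
  has_ubound (wvalues v f).
Proof. by move=> h; exists b => _ [z Gz <-]; exact: h. Qed.

Variable V : weight_seq R G.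

Lemma hull_nbhs0P A (W : set (weight R G)) (U : set (hull A W)) :
  nbhs (0 : hull A W) U -> exists n (v : 'I_n -> weight R G) e,
  [/\ 0 < e, forall i, W (v i) &
      forall y : subsp (hull_submod A W), (forall i, pnorm (v i) (subval y) < e) -> U y].
Proof.
move=> /nbhs0_lcP[n [p [e [e0 Pp pU]]]].
have /choice[v vP] i : exists v, W v /\
    forall y : subsp (hull_submod A W), p i y = pnorm v (subval y).
  by have [v [Wv ->]] := Pp i; exists v.
exists n, v, e; split=> // [i|y hy]; first by have [] := vP i.
by apply: pU => i; have [_ ->] := vP i.
Qed.

Lemma hull_bounded A (W : set (weight R G)) (B : set (hull A W)) v :
  W v -> tvs_bounded B ->
  exists c, forall f : subsp (hull_submod A W), B f -> pnorm v (subval f) <= c.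
Proof.
move=> Wv; have Pp : [set p | exists v (Wv : W v), p = psn A Wv] (psn A Wv).
  by exists v, Wv.
exact: (tvs_bounded_sn Pp).
Qed.

Lemma step_inclZ A k (a : R[i]) (f : subsp (hull_submod A [set V k : weight R G])) :
  step_incl ((a *: f : subsp (hull_submod A [set V k : weight R G])) : step V A k) =
  a *: (step_incl (f : step V A k)).
Proof. by apply: val_inj; rewrite [RHS]linearZ. Qed.

Lemma step_inclB A k (f g : subsp (hull_submod A [set V k : weight R G])) :
  step_incl ((f - g : subsp (hull_submod A [set V k : weight R G])) : step V A k) =
  step_incl (f : step V A k) - step_incl (g : step V A k).
Proof. by apply: val_inj; rewrite [RHS]raddfB. Qed.

(** By continuity q < 1 on a ball of radius e about 0; f is scaled into this ball. *)
Lemma step_bound A k (q : seminorm (subsp (ind_submod V A))) :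
  continuous (fun f : step V A k => q (step_incl f)) ->
  exists2 c, 0 < c & forall f : subsp (hull_submod A [set V k : weight R G]),
    q (step_incl (f : step V A k)) <= c * pnorm (V k) (subval f).
Proof.
move=> qc; pose S := subsp (hull_submod A [set V k : weight R G]).
pose Q (f : S) := q (step_incl (f : step V A k)).
have QZ a (f : S) : Q (a *: f) = cnorm a * Q f.
  by rewrite /Q step_inclZ snZ.
have Q0 : Q 0 = 0.
  by rewrite -[X in Q X](scale0r (0 : S)) QZ ComplexField.Normc.normc0 mul0r.
have pZ a (f : S) : pnorm (V k) (subval (a *: f : S)) = cnorm a * pnorm (V k) (subval f).
  exact: (snZ (psn A (W := [set V k : weight R G]) erefl)).
have p0 (f : S) : 0 <= pnorm (V k) (subval (f : S)).
  exact: (sn_ge0 (psn A (W := [set V k : weight R G]) erefl)).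
have /cvgrPdist_lt/(_ 1 ltr01) := qc 0.
move=> /hull_nbhs0P[n [v [e [e0 Wv hU]]]].
exists (2 / e); first by rewrite divr_gt0.
move=> f; rewrite -/(Q f); apply/ler_addgt0Pr => d d0.
(* The slack d keeps s positive when the norm of f is 0. *)
set s := pnorm (V k) (subval f) + d * e / 2.
have s0 : 0 < s by rewrite /s ltr_wpDl ?p0 // divr_gt0 // mulr_gt0.
have a0 : 0 < e / 2 / s by rewrite !divr_gt0.
have := hU ((e / 2 / s)%:C%C *: f).
rewrite -/(Q 0) Q0 sub0r normrN -/(Q _) QZ cnorm_real (gtr0_norm a0).
have -> : 2 / e * pnorm (V k) (subval f) + d = (e / 2 / s)^-1.
  rewrite !invf_div /s; field; exact: lt0r_neq0.
move=> h; rewrite -div1r ler_pdivlMr // mulrC; apply: le_trans (ltW (h _)).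
  exact: ler_norm.
move=> i; rewrite (Wv i) pZ cnorm_real gtr0_norm // mulrAC ltr_pdivrMr //.
have : pnorm (V k) (subval f) < s by rewrite /s ltrDl divr_gt0 // mulr_gt0.
by have := p0 f; nra.
Qed.

Lemma step_continuous A k (q : seminorm (subsp (ind_submod V A))) (c : R) :
  (forall f : subsp (hull_submod A [set V k : weight R G]),
    q (step_incl (f : step V A k)) <= c * pnorm (V k) (subval f)) ->
  continuous (fun f : step V A k => q (step_incl f)).
Proof.
move=> qc; pose S := subsp (hull_submod A [set V k : weight R G]).
move=> f; apply/(@cvgrPdist_lt _ _ _ (nbhs f) (nbhs_filter f)) => e e0.
pose c' := `|c| + 1; have c0 : 0 < c' by rewrite /c' ltr_wpDl.
have Pp : [set p | exists v (Wv : [set V k : weight R G] v), p = psn A Wv]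
    (psn A (W := [set V k : weight R G]) erefl) by exists (V k), erefl.
have ec0 : 0 < e / c' by rewrite divr_gt0.
apply: (@filterS _ (nbhs f) (nbhs_filter f) _ _ _ (lc_nbhs_ball f Pp ec0)).
move=> g /=; rewrite ltr_pdivlMr // => h.
have hB : q (step_incl ((g : S) - (f : S) : step V A k)) < e.
  apply: (le_lt_trans (qc _)); apply: le_lt_trans h; rewrite mulrC.
  apply: ler_wpM2l; first exact: (sn_ge0 (psn A (W := [set V k : weight R G]) erefl)).
  by rewrite /c'; have := ler_norm c; lra.
rewrite step_inclB in hB.
have h1 := snD q (step_incl g - step_incl f) (step_incl f); rewrite subrK in h1.
have h2 := snD q (step_incl f - step_incl g) (step_incl g); rewrite subrK in h2.
rewrite -opprB snN in h2; rewrite ltr_norml; lra.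
Qed.

End WeightedFacts.

Lemma subvalD (R : realType) (F : lmodType R[i]) (W : submod F) (x y : subsp W) :
  subval (x + y) = subval x + subval y.
Proof. by []. Qed.

Lemma subvalB (R : realType) (F : lmodType R[i]) (W : submod F) (x y : subsp W) :
  subval (x - y) = subval x - subval y.
Proof. by []. Qed.

Lemma subvalZ (R : realType) (F : lmodType R[i]) (W : submod F) (a : R[i])
  (x : subsp W) : subval (a *: x) = a *: subval x.
Proof. by []. Qed.

(** * Neighbourhoods in the three function spaces *)

Section CanonicalInclusions.
Context {R : realType} {X : normedModType R[i]} {G : set X} {V : weight_seq R G}.
Local Notation C := R[i].
Local Notation F := (X -> C^o).

Definition hv (f : HVbar V) : F := subval (f : subsp (hull_submod (holo_fun G) (Vbar V))).
Definition vh (f : VH V) : F := subval (f : subsp (ind_submod V (holo_fun G))).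

Lemma hvP (f : HVbar V) : submod_set (holo_fun G) (hv f) /\
  forall v, Vbar V v -> has_ubound (wvalues v (hv f)).
Proof. exact: (subsp_in (f : subsp (hull_submod (holo_fun G) (Vbar V)))). Qed.

Lemma hvD (f g : HVbar V) x : hv (f + g) x = hv f x + hv g x. Proof. by []. Qed.

Lemma hvZ (a : C) (f : HVbar V) x : hv (a *: f) x = a * hv f x. Proof. by []. Qed.

Lemma hv_VH (f : VH V) : hv (VH_to_HVbar V f) = vh f. Proof. by []. Qed.

Lemma HVbar_nbhs0P (U : set (HVbar V)) : nbhs (0 : HVbar V) U ->
  exists n (v : 'I_n -> weight R G) e, [/\ 0 < e, forall i, Vbar V (v i) &
    forall f : HVbar V, (forall i, pnorm (v i) (hv f) < e) -> U f].
Proof. exact: hull_nbhs0P. Qed.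

Lemma HVbar_bounded (B : set (HVbar V)) v : Vbar V v -> tvs_bounded B ->
  exists c, forall f : HVbar V, B f -> pnorm v (hv f) <= c.
Proof. exact: hull_bounded. Qed.

Lemma HVbar_eval_nbhs (f : HVbar V) v z e : Vbar V v -> G z -> 0 < e ->
  nbhs f [set g : HVbar V | cnorm (hv g z - hv f z) < e].
Proof.
move=> Vv Gz e0; have vz := wfun_gt0 v Gz.
have Pp : [set p | exists v (Wv : Vbar V v), p = psn (holo_fun G) Wv]
    (psn (holo_fun G) Vv) by exists v, Vv.
have ev0 : 0 < v z * e by rewrite mulr_gt0.
apply: (@filterS _ (nbhs f) (nbhs_filter f) _ _ _ (lc_nbhs_ball f Pp ev0)) => g /= h.
have [_ gb] := hvP (g - f).
rewrite -(ltr_pM2l vz); apply: le_lt_trans h.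
exact: (pnorm_ub (gb v Vv) Gz).
Qed.

(** The supremum of |g(z_n)| over n is finite because g lies in some step. It is a seminorm bounded
    by a multiple of the norm on each step, hence continuous for the inductive limit topology. *)
Lemma VH_nbhs_sup (z : nat -> X) (c : nat -> R) :
  (forall k f n, submod_set (hull_submod (holo_fun G) [set V k : weight R G]) f ->
     cnorm (f (z n)) <= c k * pnorm (V k) f) ->
  forall (f : VH V) e, 0 < e ->
  nbhs f [set g : VH V | forall n, cnorm (vh g (z n) - vh f (z n)) < e].
Proof.
move=> cP; pose S := subsp (ind_submod V (holo_fun G)).
pose A (f : S) := [set cnorm (subval f (z n)) | n in [set: nat]].
have A0 (f : S) : A f !=set0 by exists (cnorm (subval f (z 0%N))), 0%N.
have Ab (f : S) : has_ubound (A f).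
  have [k _ fk] := subsp_in f.
  by exists (c k * pnorm (V k) (subval f)) => _ [n _ <-]; exact: cP.
have Aub (f : S) n : cnorm (subval f (z n)) <= sup (A f).
  by apply: ub_le_sup => //; exists n.
have AD (f g : S) : sup (A (f + g)) <= sup (A f) + sup (A g).
  apply: ge_sup => // _ [n _ <-]; rewrite subvalD.
  by apply: (le_trans (cnormD _ _)); apply: lerD; exact: Aub.
have AZle (a : C) (f : S) : sup (A (a *: f)) <= cnorm a * sup (A f).
  apply: ge_sup => // _ [n _ <-]; rewrite subvalZ [cnorm _]cnormM.
  by rewrite ler_wpM2l ?cnorm_ge0 ?Aub.
have AZ (a : C) (f : S) : sup (A (a *: f)) = cnorm a * sup (A f).
  apply/le_anti; rewrite AZle /=; have [->|a0] := eqVneq a 0.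
    rewrite ComplexField.Normc.normc0 mul0r; apply: le_trans (Aub _ 0%N).
    exact: cnorm_ge0.
  rewrite mulrC -ler_pdivlMr ?cnorm_gt0 // mulrC -cnormV.
  by rewrite -[X in sup (A X) <= _](scalerK a0).
pose q := Seminorm AD AZ.
have Pq : [set q : seminorm (subsp (ind_submod V (holo_fun G))) |
    forall k, continuous (fun f : step V (holo_fun G) k => q (step_incl f))] q.
  move=> k; apply: (@step_continuous _ _ _ _ _ _ _ (c k)) => f.
  have fk := subsp_in f.
  by apply: ge_sup => // _ [n _ <-]; exact: cP.
move=> f e e0.
apply: (@filterS _ (nbhs f) (nbhs_filter f) _ _ _ (lc_nbhs_ball f Pq e0)) => g /= h n.
apply: le_lt_trans h.
have -> : vh g (z n) - vh f (z n) = subval ((g : S) - (f : S)) (z n) by rewrite subvalB.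
exact: Aub.
Qed.

(** Finitely many continuous seminorms are bounded on step k by constants times its norm, and the
    sums of these constants form the sequence c. As the constants depend on the neighbourhood, the
    splitting must be possible for every c; its pieces may lie in different steps. *)
Lemma VC_nbhs0 (f : nat -> VH V) :
  (forall (c : nat -> R) e, (forall k, 0 < c k) -> 0 < e -> exists J, forall j,
     (J <= j)%N -> exists k l (f1 f2 : F),
     [/\ submod_set (hull_submod (cont_fun G) [set V k : weight R G]) f1,
         submod_set (hull_submod (cont_fun G) [set V l : weight R G]) f2,
         vh (f j) = f1 + f2 &
         c k * pnorm (V k) f1 + c l * pnorm (V l) f2 <= e]) ->
  forall U : set (VC V), nbhs (0 : VC V) U -> exists j, U (VH_to_VC V (f j)).
Proof.
move=> H U /nbhs0_lcP[n [p [e [e0 Pp pU]]]].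
pose A := cont_fun G.
have /choice[c cP] i : exists c : nat -> R, forall k, 0 < c k /\
    forall f : subsp (hull_submod A [set V k : weight R G]),
    p i (step_incl (f : step V A k)) <= c k * pnorm (V k) (subval f).
  have /choice[c cP] k : exists c, 0 < c /\
      forall f : subsp (hull_submod A [set V k : weight R G]),
      p i (step_incl (f : step V A k)) <= c * pnorm (V k) (subval f).
    by have [c c0 cP] := step_bound (Pp i k); exists c.
  by exists c.
pose d k := 1 + \sum_i c i k.
have d0 k : 0 < d k.
  by rewrite /d ltr_wpDr // sumr_ge0 // => i _; exact/ltW/(cP i k).1.
have cd i k : c i k <= d k.
  rewrite /d (bigD1 i) //=.
  have : 0 <= \sum_(j | j != i) c j k by apply: sumr_ge0 => j _; exact/ltW/(cP j k).1.
  by lra.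
have e20 : 0 < e / 2 by lra.
have [J /(_ J (leqnn J))[k [l [f1 [f2 [h1 h2 fE fe]]]]]] := H d _ d0 e20.
exists J; apply: pU => i.
pose s1 := to_subsp h1; pose s2 := to_subsp h2.
have p1 : 0 <= pnorm (V k) f1.
  exact: (sn_ge0 (psn A (W := [set V k : weight R G]) erefl) s1).
have p2 : 0 <= pnorm (V l) f2.
  exact: (sn_ge0 (psn A (W := [set V l : weight R G]) erefl) s2).
have -> : VH_to_VC V (f J) = step_incl (s1 : step V A k) + step_incl (s2 : step V A l).
  exact: val_inj.
apply: (le_lt_trans (snD _ _ _)).
have k1 : p i (step_incl (s1 : step V A k)) <= d k * pnorm (V k) f1.
  by apply: (le_trans ((cP i k).2 s1)); apply: ler_wpM2r.
have k2 : p i (step_incl (s2 : step V A l)) <= d l * pnorm (V l) f2.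
  by apply: (le_trans ((cP i l).2 s2)); apply: ler_wpM2r.
by lra.
Qed.

Lemma VH_bounded_seq (f : nat -> VH V) k M :
  (forall j, submod_set (hull_submod (holo_fun G) [set V k : weight R G]) (vh (f j))) ->
  (forall j, pnorm (V k) (vh (f j)) <= M) -> tvs_bounded (range f).
Proof.
move=> fk fM; apply: sn_tvs_bounded => p Pp.
have [c c0 cP] := step_bound (Pp k).
exists (c * M) => _ [j _ <-].
have -> : p (f j) = p (step_incl (to_subsp (fk j) : step V (holo_fun G) k)).
  by congr (p _); exact: val_inj.
by apply: (le_trans (cP _)); rewrite ler_pM2l //; exact: fM.
Qed.

Definition eval (z : X) (f : HVbar V) : C^o := hv f z.

Lemma eval_is_linear z : linear (eval z).
Proof. by []. Qed.

HB.instance Definition _ z := GRing.isLinear.Build C (HVbar V) C^o *:%R (eval z)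
  (eval_is_linear z).

End CanonicalInclusions.

(** * The concrete space *)

Section ConcreteSpace.
Context {R : realType} {Lam : weight_seq R [set: nat]} {w : nat -> R -> R}.
Hypothesis Lam_bounds : forall k n : nat, (n.+1%:R ^+ 2)^-1 <= Lam k n <= 1.
Hypothesis hw : angular_weights Lam w.
Local Notation C := R[i].
Local Notation X := (C^o * C^o)%type.
Local Notation V := (v_seq hw).
Implicit Types (z : X).

Lemma V_le1 k z : G12 z -> V k z <= 1.
Proof.
move=> Gz; have [Az _] := G1_Arg Gz.
have /andP[h1 h2] := angular_bounds Lam_bounds hw k Az.
have /andP[h3 h4] := u_weight_bounds k Gz (cnorm_ge0 z.2).
rewrite -[leRHS]mulr1; apply: ler_pM => //.
  by apply: le_trans h1; rewrite divr_ge0 // sqr_ge0.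
by apply/ltW/u_weight_gt0 => //; exact: cnorm_ge0.
Qed.

(** A minorant on [G12] of all the angular factors at once, continuous everywhere and therefore fit
    for building elements of [Vbar]. *)
Definition height z : R := complex.Im z.1 ^+ 2 / 16.

Lemma height_bounds k z : G12 z -> 0 < height z <= w k (Arg z.1).
Proof.
move=> Gz; have [Az IA] := G1_Arg Gz; have /G1E[_ I0] := Gz.
have /andP[h1 h2] := angular_bounds Lam_bounds hw k Az.
rewrite /height divr_gt0 ?exprn_gt0 //=; apply: le_trans h1.
rewrite ler_wpM2r // ler_pXn2r ?nnegrE //; first exact: ltW.
by case/andP: Az => /ltW.
Qed.

Lemma V_lb k z : G12 z ->
  height z * (1 + (dist_compl z.1)^-1 + cnorm z.2)^-1 <= V k z.
Proof.
move=> Gz; have /andP[h1 h2] := height_bounds k Gz.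
have /andP[h3 h4] := u_weight_bounds k Gz (cnorm_ge0 z.2).
apply: ler_pM => //; first exact: ltW.
have /dist_compl_itv/andP[d0 _] := Gz.
by rewrite invr_ge0 !addr_ge0 ?cnorm_ge0 // invr_ge0 ltW.
Qed.

(** For such z2 the distance to the boundary does not enter, so the bound persists as z1 tends to
    i. *)
Lemma V_far_lb k z : G12 z -> k%:R + 2 <= cnorm z.2 ->
  height z * (1 + cnorm z.2)^-1 <= V k z.
Proof.
move=> Gz tk; have /andP[h1 h2] := height_bounds k Gz.
have h3 := u_weight_far_lb Gz tk.
apply: ler_pM => //; first exact: ltW.
by rewrite invr_ge0 addr_ge0 ?cnorm_ge0.
Qed.

Lemma V_le_u k z : G12 z -> V k z <= u_weight k.+1 z.1 (cnorm z.2).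
Proof.
move=> Gz; have [Az _] := G1_Arg Gz.
have /andP[h1 h2] := angular_bounds Lam_bounds hw k Az.
by rewrite /= ler_piMl // ltW // u_weight_gt0 // cnorm_ge0.
Qed.

Lemma V_far_small (eps : R) : 0 < eps -> exists2 T : R, 0 <= T &
  forall z, G12 z -> T <= cnorm z.2 -> V 1%N z <= eps.
Proof.
move=> /u_weight_far_small[T T0 TP]; exists T => // z Gz hz.
by apply: (le_trans (V_le_u 1 Gz)); exact: TP.
Qed.

Lemma V_bdry_small (eps : R) : 0 < eps -> exists2 d : R, 0 < d &
  forall k z, G12 z -> cnorm z.2 <= k%:R -> dist_compl z.1 <= d -> V k.+1 z <= eps.
Proof.
move=> /u_weight_bdry_small[d d0 dP]; exists d => // k z Gz hz hd.
apply: (le_trans (V_le_u k.+1 Gz)); apply: dP => //.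
by rewrite cnorm_ge0.
Qed.

Lemma cnorm_expr (x : C) j : cnorm (x ^+ j) = cnorm x ^+ j.
Proof.
elim: j => [|j IH]; first by rewrite !expr0; exact: ComplexField.Normc.normc1.
by rewrite !exprS cnormM IH.
Qed.

(** The factor 2 makes the modulus exceed 1 as soon as |z1|^j > 1/2. *)
Definition peak (j : nat) : X -> C^o :=
  fun z => if `[< G12 z >] then 2 * z.1 ^+ j else 0.

Lemma cnorm_peak j z : G12 z -> cnorm (peak j z) = 2 * cnorm z.1 ^+ j.
Proof.
move=> Gz; rewrite /peak asboolT // cnormM cnorm_expr; congr (_ * _).
have -> : (2 : C) = (2 : R)%:C%C by rewrite rmorph_nat.
by rewrite cnorm_real ger0_norm.
Qed.

Lemma peak_le2 j z : cnorm (peak j z) <= 2.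
Proof.
have [Gz|nGz] := pselect (G12 z); last first.
  by rewrite /peak asboolF // [cnorm 0]ComplexField.Normc.normc0.
rewrite cnorm_peak // ger_pMr // exprn_ile1 ?cnorm_ge0 //.
by case: Gz => /andP[_ /ltW].
Qed.

Lemma cnorm_near (x : C^o) (e : R) : 0 < e -> \forall y \near x, cnorm (y - x) < e.
Proof.
move=> e0; have eC : 0 < e%:C%C :> C by rewrite ltcR.
exists e%:C%C => // y /=.
by rewrite /ball_ /= distrC normr_cnorm ltcR.
Qed.

Lemma cnorm_dist (x y : C) : `|cnorm x - cnorm y| <= cnorm (x - y).
Proof.
have := cnormD (x - y) y; have := cnormD (y - x) x; rewrite !subrK.
by rewrite -[cnorm (y - x)]cnormN opprB ler_norml; lra.
Qed.

Lemma cnorm_lip_continuous (f : C^o -> R) :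
  (forall x y, `|f x - f y| <= cnorm (x - y)) -> continuous f.
Proof.
move=> hf x; apply/(@cvgrPdist_lt _ _ _ (nbhs x) (nbhs_filter x)) => e e0.
apply: filterS (cnorm_near x e0) => y; apply: le_lt_trans.
by rewrite distrC.
Qed.

Lemma continuous_cnorm : continuous (fun x : C^o => cnorm x : R).
Proof. exact: cnorm_lip_continuous cnorm_dist. Qed.

Lemma continuous_Im : continuous (fun x : C^o => complex.Im x : R).
Proof.
apply: cnorm_lip_continuous => x y; apply: le_trans (Im_le_cnorm _).
by rewrite ImB.
Qed.

Lemma continuous_dist_compl : continuous (fun x : C^o => dist_compl x : R).
Proof.
have ne : (~` (@G1 R)) !=set0.
  by exists 0 => -[]; rewrite [cnorm _]ComplexField.Normc.normc0; lra.
have le x y : dist_compl x <= dist_compl y + cnorm (x - y) :> R.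
  rewrite -lerBlDr; apply: lb_le_inf; first by have [u Gu] := ne; exists (cnorm (y - u)), u.
  move=> _ [u Gu <-]; rewrite lerBlDr; apply: (@le_trans _ _ (cnorm (x - u))).
    by apply: ge_inf; [exists 0 => _ [? _ <-]; exact: cnorm_ge0|exists u].
  by have := cnormD (x - y) (y - u); rewrite addrA subrK [leRHS]addrC.
apply: cnorm_lip_continuous => x y.
have := le x y; have := le y x; rewrite -[cnorm (y - x)]cnormN opprB ler_norml; lra.
Qed.

Lemma G12_nbhs z : G12 z -> \forall y \near z, G12 y.
Proof.
move=> /G1E[/andP[z1 z2] I0].
have c1 : continuous (fun y : X => cnorm y.1).
  by move=> y; apply: continuous_comp; [exact: cvg_fst|exact: continuous_cnorm].
have c2 : continuous (fun y : X => complex.Im y.1).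
  by move=> y; apply: continuous_comp; [exact: cvg_fst|exact: continuous_Im].
have Fz := nbhs_filter z.
have h1 := @cvgr_gt _ _ _ Fz _ _ (c1 z) _ z1.
have h2 := @cvgr_lt _ _ _ Fz _ _ (c1 z) _ z2.
have h3 := @cvgr_gt _ _ _ Fz _ _ (c2 z) _ I0.
apply: (@filterS _ _ Fz _ _ _ (@filterI _ _ Fz _ _ (@filterI _ _ Fz _ _ h1 h2) h3)).
move=> y [[k1 k2] k3].
by apply/G1E; split => //; apply/andP; split.
Qed.

Lemma peak_holo j : submod_set (holo_fun (@G12 R)) (peak j).
Proof.
split=> [z Gz|z Gz]; last by rewrite /peak asboolF.
apply: (near_eq_differentiable (f := fun y : X => (2 : C) *: ((y.1 : C^o) ^+ j))).
  by apply: filterS (G12_nbhs Gz) => y Gy; rewrite /peak asboolT.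
apply: differentiableZ.
have -> : (fun y : X => (y.1 : C^o) ^+ j) = (@fst C^o C^o) ^+ j.
  by apply: funext => y; rewrite exprfctE.
case: j => [|j]; first by rewrite expr0; exact: differentiable_cst.
apply: differentiableX.
apply: (@linear_differentiable _ _ _ (@fst C^o C^o)) => y; exact: cvg_fst.
Qed.

(** The shift by 4 keeps the modulus at least 3/4, which gives a height of at least 9/256 > 1/32. *)
Definition zpt (n : nat) : X := ((0 +i* (1 - (n%:R + 4)^-1))%C, 0).

Lemma zptP n : [/\ G12 (zpt n), cnorm (zpt n).1 = 1 - (n%:R + 4)^-1 &
  1 / 32 <= height (zpt n)].
Proof.
have n0 : 0 <= n%:R :> R by [].
have i1 : (n%:R + 4)^-1 <= 4^-1 :> R by rewrite lef_pV2 ?posrE //; lra.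
have i0 : 0 < (n%:R + 4)^-1 :> R by rewrite invr_gt0; lra.
have E : cnorm (zpt n).1 = 1 - (n%:R + 4)^-1.
  by rewrite /= expr0n add0r sqrtr_sqr ger0_norm //; lra.
split=> //.
  by apply/G1E; rewrite E /=; split; lra.
rewrite /height /=; move: i1 i0; set x := _^-1; nra.
Qed.

(** The slice y |-> f (x, y) is entire, since the second factor of G is the whole plane. *)
Lemma holo_slice_bound (f : X -> C^o) (x : C^o) (t M : R) :
  submod_set (holo_fun (@G12 R)) f -> G1 x -> 0 < t ->
  (forall y : C^o, t <= cnorm y <= 2 * t -> cnorm (f (x, y)) <= M) ->
  cnorm (f (x, 0)) <= 2 * M.
Proof.
move=> [df _] Gx t0 fM.
apply: (@entire_bound _ (fun y : C^o => f (x, y)) t M) => // y.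
apply: (@differentiable_comp _ _ _ _ (fun y : C^o => (x, y)) f).
  apply: differentiable_pair; first exact: differentiable_cst.
  by apply: (@linear_differentiable _ _ _ idfun) => ?.
exact: df.
Qed.

End ConcreteSpace.

(** * A continuous increasing majorant of a sequence *)

Section Majorant.
Context {R : realType}.

(** The j-th term is 0 for t <= j and equals |E (j+1)| at t = j + 1. The series is thus locally
    finite, and any truncation index N >= t gives the same value. *)
Lemma continuous_majorant (E : nat -> R) : exists D : R -> R,
  [/\ continuous D, forall s t, s <= t -> D s <= D t, forall t, 1 <= D t &
      forall j, E j.+1 <= D j.+1%:R].
Proof.
pose term j (t : R) := `|E j.+1| * Num.max 0 (t - j%:R).
pose S N t := 1 + \sum_(j < N) term j t.
pose D t := S (Num.bound `|t|) t.
have term_ge0 j t : 0 <= term j t by rewrite mulr_ge0 // le_max lexx.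
have term_mono j s t : s <= t -> term j s <= term j t.
  move=> st; rewrite ler_wpM2l // ge_max le_max lexx /= le_max.
  by rewrite lerD2r st orbT.
have Sext M N t : (M <= N)%N -> t <= M%:R -> S N t = S M t.
  move=> /subnKC <- tM; elim: (N - M)%N => [|n IH]; first by rewrite addn0.
  rewrite addnS /S big_ord_recr /= addrA -/(S (M + n)%N t) IH /term max_l ?mulr0 ?addr0 //.
  by rewrite subr_le0 (le_trans tM) // ler_nat leq_addr.
have bnd t : t <= (Num.bound `|t|)%:R :> R.
  by apply: (le_trans (ler_norm t)); apply/ltW/archi_boundP.
have DS N t : t <= N%:R -> D t = S N t.
  move=> tN; rewrite /D -(Sext _ (maxn (Num.bound `|t|) N)) ?leq_maxl //.
  by rewrite -(Sext N (maxn (Num.bound `|t|) N)) ?leq_maxr.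
have Sc N : continuous (S N : R -> R).
  have Tc j : continuous (term j : R -> R).
    move=> t; apply: cvgM; first exact: cvg_cst.
    apply: (@continuous_max R R (fun=> 0) (fun t => t - j%:R)).
      exact: cvg_cst.
    by apply: cvgB; [exact: cvg_id|exact: cvg_cst].
  elim: N => [|N IH].
    have -> : S 0%N = fun=> 1 by apply: funext => t; rewrite /S big_ord0 addr0.
    by move=> t; exact: cvg_cst.
  have -> : S N.+1 = fun t => S N t + term N t.
    by apply: funext => t; rewrite /S big_ord_recr /= addrA.
  by move=> t; apply: cvgD; [exact: IH|exact: Tc].
exists D; split.
- move=> t; pose N := (Num.bound `|t|).+1.
  have tN : t < N%:R by apply: (le_lt_trans (bnd t)); rewrite ltr_nat.
  rewrite /continuous_at (DS N); last exact: ltW.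
  apply: cvg_trans (Sc N t); apply: near_eq_cvg.
  near=> s; apply/esym/DS/ltW; near: s.
  exact: (@cvgr_lt _ _ _ (nbhs_filter t) id t cvg_id _ tN).
- move=> s t st; rewrite (DS (Num.bound `|t|) s) ?(le_trans st) // (DS _ t (bnd t)).
  by rewrite lerD2l; apply: ler_sum => j _; exact: term_mono.
- by move=> t; rewrite /D /S lerDl sumr_ge0.
- move=> j; rewrite (DS j.+1) // /S big_ord_recr /= /term.
  have -> : j.+1%:R - j%:R = 1 :> R by rewrite -natr1 addrAC subrr add0r.
  rewrite max_r // mulr1.
  have : 0 <= \sum_(i < j) term i j.+1%:R by apply: sumr_ge0.
  by rewrite /term; have := ler_norm (E j.+1); lra.
Unshelve. all: by end_near.
Qed.

End Majorant.

(** * Continuous weights dominated by all v_k *)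

Section VbarWeight.
Context {R : realType} {Lam : weight_seq R [set: nat]} {w : nat -> R -> R}.
Hypothesis Lam_bounds : forall k n : nat, (n.+1%:R ^+ 2)^-1 <= Lam k n <= 1.
Hypothesis hw : angular_weights Lam w.
Local Notation C := R[i].
Local Notation X := (C^o * C^o)%type.
Local Notation V := (v_seq hw).

(** The first term of the minimum gives domination by the weight [V k] for |z2| >= k + 2, the second
    one for |z2| < k + 2. The growth of D is at one's disposal and decides how close to the boundary
    of [G1] the second term takes effect. *)
Lemma Vbar_weight (D : R -> R) : continuous D -> (forall s t, s <= t -> D s <= D t) ->
  (forall t, 1 <= D t) -> exists2 v : weight R (@G12 R), Vbar V v &
  forall z, v z = height z * Num.min (1 + cnorm z.2)^-1 (dist_compl z.1 * D (cnorm z.2)).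
Proof.
move=> Dc Dm D1.
pose f (z : X) : R := height z * Num.min (1 + cnorm z.2)^-1 (dist_compl z.1 * D (cnorm z.2)).
have t1 (z : X) : 0 < 1 + cnorm z.2 by have := cnorm_ge0 z.2; lra.
have f0 z : G12 z -> 0 < f z.
  move=> Gz; have /andP[h0 _] := height_bounds Lam_bounds hw 0 Gz.
  have /dist_compl_itv/andP[d0 _] := Gz.
  rewrite mulr_gt0 // lt_min invr_gt0 t1 mulr_gt0 //.
  by apply: lt_le_trans (D1 _).
exists (Weight f0) => //; split.
  (* With d the distance of z1 and |z2| < k + 2, d (1 + 1/d + |z2|) <= 2 + |z2| <= k + 4, and D is
     at most D (k + 2). *)
  move=> k; exists (D (k%:R + 2) * (k%:R + 4)).
    by rewrite mulr_gt0 //; apply: lt_le_trans (D1 _).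
  move=> z Gz; rewrite /= -[X in _ <= _ * X]/(V k z).
  have /andP[h0 _] := height_bounds Lam_bounds hw 0 Gz.
  have /dist_compl_itv/andP[d0 d1] := Gz.
  have k0 : 0 <= k%:R :> R by [].
  have c1 : 1 <= D (k%:R + 2) * (k%:R + 4).
    by have := D1 (k%:R + 2); nra.
  have [tk|tk] := leP (k%:R + 2) (cnorm z.2).
    apply: (@le_trans _ _ (height z * (1 + cnorm z.2)^-1)).
      by rewrite /f ler_pM2l // ge_min lexx.
    apply: (le_trans (V_far_lb Lam_bounds hw Gz tk)).
    by rewrite ler_peMl // ltW // wfun_gt0.
  apply: (@le_trans _ _ (height z * (dist_compl z.1 * D (k%:R + 2)))).
    rewrite /f ler_pM2l // ge_min; apply/orP; right.
    by rewrite ler_pM2l //; apply/Dm/ltW.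
  apply: (@le_trans _ _ (D (k%:R + 2) * (k%:R + 4) *
     (height z * (1 + (dist_compl z.1)^-1 + cnorm z.2)^-1))); last first.
    by apply: ler_wpM2l; [lra|exact: V_lb].
  have -> : height z * (dist_compl z.1 * D (k%:R + 2)) =
      D (k%:R + 2) * height z * dist_compl z.1 by ring.
  have -> : D (k%:R + 2) * (k%:R + 4) *
     (height z * (1 + (dist_compl z.1)^-1 + cnorm z.2)^-1) =
     D (k%:R + 2) * height z * ((k%:R + 4) * (1 + (dist_compl z.1)^-1 + cnorm z.2)^-1).
    by ring.
  apply: ler_wpM2l.
    by rewrite mulr_ge0 ?(ltW h0) //; apply: le_trans (D1 _).
  have dV : 1 <= (dist_compl z.1)^-1 by rewrite invf_ge1.
  rewrite ler_pdivlMr; last by have := t1 z; lra.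
  rewrite !mulrDr mulfV ?gt_eqF // mulr1.
  have t0 := cnorm_ge0 z.2.
  have dt : dist_compl z.1 * cnorm z.2 <= cnorm z.2 by rewrite ler_piMl.
  by lra.
suff fc : continuous (f : X -> R) by exact: (continuous_subspaceT fc).
have c1 : continuous (fun y : X => dist_compl y.1 : R).
  by move=> y; apply: (@continuous_comp X C^o R (@fst C^o C^o) (fun x => dist_compl x));
    [exact: cvg_fst|exact: continuous_dist_compl].
have c2 : continuous (fun y : X => cnorm y.2 : R).
  by move=> y; apply: (@continuous_comp X C^o R (@snd C^o C^o) (fun x => cnorm x));
    [exact: cvg_snd|exact: continuous_cnorm].
have c3 : continuous (fun y : X => complex.Im y.1 : R).
  by move=> y; apply: (@continuous_comp X C^o R (@fst C^o C^o) (fun x => complex.Im x));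
    [exact: cvg_fst|exact: continuous_Im].
move=> z; apply: cvgM.
  apply: cvgM; last exact: cvg_cst.
  exact: (cvgM (c3 z) (c3 z)).
apply: (@continuous_min R X (fun y => (1 + cnorm y.2)^-1)
  (fun y => dist_compl y.1 * D (cnorm y.2))).
  apply: cvgV; first by rewrite gt_eqF.
  by apply: cvgD; [exact: cvg_cst|exact: c2].
apply: cvgM; first exact: c1.
apply: (@continuous_comp X R R (fun y => cnorm y.2) D); first exact: c2.
exact: Dc.
Qed.

End VbarWeight.

(** * Estimates at the points z_n and for the peaks *)

Section PeakEstimates.
Context {R : realType} {Lam : weight_seq R [set: nat]} {w : nat -> R -> R}.
Hypothesis Lam_bounds : forall k n : nat, (n.+1%:R ^+ 2)^-1 <= Lam k n <= 1.
Hypothesis hw : angular_weights Lam w.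
Local Notation C := R[i].
Local Notation X := (C^o * C^o)%type.
Local Notation V := (v_seq hw).
Local Notation holo := (holo_fun (@G12 R)).

(** On the annulus the weight gives |f| <= [pnorm v f / c], and the slice bound carries this to y =
    0, where v itself may be very small. *)
Lemma zpt_bound (v : weight R (@G12 R)) (f : X -> C^o) n (t c : R) :
  submod_set holo f -> has_ubound (wvalues v f) -> 0 < t -> 0 < c ->
  (forall y : C^o, t <= cnorm y <= 2 * t -> c <= v ((zpt n).1, y)) ->
  cnorm (f (zpt n)) <= 2 * (pnorm v f / c).
Proof.
move=> hf fb t0 c0 vc; have [Gn _ _] := @zptP R n.
apply: (holo_slice_bound hf Gn t0) => y hy.
have Gy : G12 ((zpt n).1, y) by [].
rewrite ler_pdivlMr // mulrC; apply: le_trans (pnorm_ub fb Gy).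
by apply: ler_wpM2r; [exact: cnorm_ge0|exact: vc].
Qed.

(** A factor 2 from the Cauchy estimate, 32 from the height, and 1 + |y| <= 1 + 2 t on the annulus
    with t = k + 2. *)
Definition step_const k : R := 64 * (1 + 2 * (k%:R + 2)).

Lemma step_zpt_bound k (f : X -> C^o) n :
  submod_set (hull_submod holo [set V k : weight R (@G12 R)]) f ->
  cnorm (f (zpt n)) <= step_const k * pnorm (V k) f.
Proof.
move=> [hf fb]; have k0 : 0 <= k%:R :> R by [].
pose t : R := k%:R + 2; have t0 : 0 < t by rewrite /t; lra.
have -> : step_const k * pnorm (V k) f =
    2 * (pnorm (V k) f / (32^-1 * (1 + 2 * t)^-1)).
  by rewrite /step_const -/t; field; rewrite lt0r_neq0 //; lra.
apply: (@zpt_bound _ _ _ t) => //; first exact: fb.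
  by rewrite mulr_gt0 // invr_gt0; lra.
move=> y /andP[y1 y2]; have [Gn _ hn] := @zptP R n.
have Gy : G12 ((zpt n).1, y) by [].
apply: le_trans (V_far_lb Lam_bounds hw Gy y1).
apply: ler_pM => //.
- by rewrite invr_ge0; lra.
- by move: hn; rewrite div1r.
- by rewrite lef_pV2 ?posrE /=; lra.
Qed.

(** Otherwise there are f_j in B and indices n_j with |f_j(z_(n_j))| > c_j. Choosing D (j + 1) >= 1
    / d(z_(n_j)) yields one weight in [Vbar] that is bounded below on the annulus j + 1 <= |y| <= 2
    (j + 1) over each z_(n_j). The Cauchy estimate then contradicts the bound K of its seminorm on B
    once j >= K. *)
Lemma HVbar_zpt_bounded (B : set (HVbar V)) : tvs_bounded B ->
  exists c, forall f n, B f -> cnorm (hv f (zpt n)) <= c.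
Proof.
move=> Bb; apply/not_existsP => noc.
(* This is the bound of [zpt_bound] for t = j + 1 when the seminorm of f is j + 1. *)
pose c j : R := 64 * (j%:R + 1) * (1 + 2 * (j%:R + 1)).
have /choice[F FP] j : exists fn : HVbar V * nat,
    B fn.1 /\ c j < cnorm (hv fn.1 (zpt fn.2)).
  apply: contrapT => h; apply: (noc (c j)) => f n Bf.
  by rewrite leNgt; apply/negP => k; apply: h; exists (f, n).
pose d j : R := dist_compl (zpt (F j).2).1.
(* The predecessor compensates the shift in [continuous_majorant]: D at j + 1 majorizes the inverse
   of [d j]. *)
have [D [Dc Dm D1 DE]] := continuous_majorant (fun j => (d j.-1)^-1).
have [v Vv vE] := Vbar_weight Lam_bounds hw Dc Dm D1.
have [K KP] := HVbar_bounded Vv Bb.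
pose j := Num.bound `|K|.
have Kj : K <= j%:R by apply: (le_trans (ler_norm _)); apply/ltW/archi_boundP.
have [BF cF] := FP j; move: cF; apply/negP; rewrite -leNgt.
have j0 : 0 <= j%:R :> R by [].
pose t : R := j%:R + 1; have t0 : 0 < t by rewrite /t; lra.
have [hF Fb] := hvP (F j).1.
have := @zpt_bound v _ (F j).2 t (32^-1 * (1 + 2 * t)^-1) hF (Fb v Vv) t0.
have c0 : 0 < 32^-1 * (1 + 2 * t)^-1 by rewrite mulr_gt0 // invr_gt0; lra.
have vlow (y : C^o) : t <= cnorm y <= 2 * t ->
    32^-1 * (1 + 2 * t)^-1 <= v ((zpt (F j).2).1, y).
  move=> /andP[y1 y2]; have [Gn _ hn] := @zptP R (F j).2.
  rewrite vE; apply: ler_pM => //.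
  - by rewrite invr_ge0; lra.
  - by move: hn; rewrite div1r.
  rewrite /= le_min; apply/andP; split.
    by rewrite lef_pV2 ?posrE; lra.
  apply: (@le_trans _ _ 1); first by rewrite invf_le1; lra.
  have /dist_compl_itv/andP[d0 _] := Gn.
  rewrite -ler_pdivrMl // mulr1.
  apply: (le_trans (DE j)); rewrite -natr1; exact: Dm.
move=> /(_ c0 vlow) h; apply: (le_trans h).
have pK : pnorm v (hv (F j).1) <= j%:R by apply: le_trans Kj; exact: KP.
have -> : c j = 2 * ((j%:R + 1) / (32^-1 * (1 + 2 * t)^-1)).
  by rewrite /c -/t; field; rewrite lt0r_neq0 //; lra.
rewrite ler_pM2l // ler_pM2r ?invr_gt0 //.
by lra.
Qed.

(** Bernoulli's inequality: for m = 2 j and x = 1 / (2 j + 4), (1 - x)^j >= 1 - j x > 1/2. *)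
Lemma peak_near1 j : exists m, 1 < cnorm (peak j (zpt m : X)).
Proof.
exists (2 * j)%N; have [Gn En _] := @zptP R (2 * j); rewrite cnorm_peak // En.
set x := (_ + 4)^-1.
have j0 : 0 <= j%:R :> R by [].
have x0 : 0 < x by rewrite /x invr_gt0 natrM; lra.
have x1 : x <= 1 by rewrite /x invf_le1 natrM; lra.
have jx : j%:R * x < 1 / 2.
  by rewrite /x natrM ltr_pdivrMr; lra.
suff gen i (y : R) : 0 < y -> y <= 1 -> 1 - i%:R * y <= (1 - y) ^+ i.
  by have := gen j x x0 x1; lra.
elim: i => [|i IH] y0 y1; first by rewrite mul0r subr0 expr0.
rewrite exprS; apply: (@le_trans _ _ ((1 - y) * (1 - i%:R * y))).
  have i0 : 0 <= i%:R :> R by [].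
  by rewrite -natr1; nra.
by rewrite ler_wpM2l ?subr_ge0 // IH.
Qed.

Lemma peak_small_inside (d eps : R) : 0 < d -> 0 < eps -> exists J, forall j z,
  (J <= j)%N -> G12 z -> d <= dist_compl z.1 -> cnorm (peak j z) <= eps.
Proof.
move=> d0 e0; pose r := Num.max 0 (1 - d).
have r0 : 0 <= r by rewrite /r le_max lexx.
have r1 : `|r| < 1 by rewrite ger0_norm // /r gt_max; lra.
have e20 : 0 < eps / 2 by lra.
have /cvgrPdist_lt/(_ _ e20)[J _ JP] := cvg_expr r1.
exists J => j z Jj Gz hd; have := JP j Jj.
rewrite /= sub0r normrN ger0_norm ?exprn_ge0 // cnorm_peak // => h.
have hz : cnorm z.1 <= r by have := dist_compl_le Gz; rewrite /r le_max; lra.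
have : cnorm z.1 ^+ j <= r ^+ j by rewrite lerXn2r ?nnegrE ?cnorm_ge0.
lra.
Qed.

(** Three regions: for |z2| >= T the weight [V 1] is small; for |z2| < T near the boundary of [G1] a
    later weight is small; elsewhere the peaks are small once j is large. In the first two regions
    |f_j| <= 2 accounts for eps / 2. *)
Lemma peak_dominated_small (v : weight R (@G12 R)) (eps : R) :
  dominated V v -> 0 < eps -> exists J, forall j, (J <= j)%N -> pnorm v (peak j) <= eps.
Proof.
move=> dv e0; have [c1 c10 c1P] := dv 1%N; have [c0 c00 c0P] := dv 0%N.
have e1 : 0 < eps / 2 / c1 by rewrite !divr_gt0.
have [T T0 TP] := V_far_small Lam_bounds hw e1.
pose K := Num.bound T; have TK : T < K%:R by exact: archi_boundP.
have [c2 c20 c2P] := dv K.+1.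
have e2 : 0 < eps / 2 / c2 by rewrite !divr_gt0.
have [d d0 dP] := V_bdry_small Lam_bounds hw e2.
have e3 : 0 < eps / c0 by rewrite !divr_gt0.
have [J JP] := peak_small_inside d0 e3.
exists J => j Jj; apply: pnorm_le; first exact: ltW.
move=> z Gz; have z0 := cnorm_ge0 (peak j z); have z2 := peak_le2 j z.
have vz := wfun_gt0 v Gz.
have [hT|hT] := leP T (cnorm z.2).
  have := c1P z Gz; have := TP z Gz hT; rewrite ler_pdivlMr // => h1 h2.
  have : v z <= eps / 2 by lra.
  by nra.
have [hd|/ltW hd] := leP (dist_compl z.1) d.
  have := dP K z Gz (ltW (lt_trans hT TK)) hd; rewrite ler_pdivlMr // => h1.
  have h2 := c2P z Gz; have : v z <= eps / 2 by lra.
  by nra.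
have := JP j z Jj Gz hd; rewrite ler_pdivlMr // => h1.
have h2 := c0P z Gz; have h3 := V_le1 Lam_bounds hw 0 Gz.
have : v z <= c0 by nra.
by nra.
Qed.

End PeakEstimates.

(** * Consequences of a peaking sequence *)

Section PeakingSequence.
Context {R : realType} {X : normedModType R[i]} {G : set X} {V : weight_seq R G}.
Local Notation C := R[i].
Local Notation F := (X -> C^o).
Variables (z : nat -> X) (f : nat -> VH V).
Hypothesis peaked : forall j, exists n, 1 < cnorm (vh (f j) (z n)).

Section NotInduced.
Variable c : nat -> R.
Hypothesis step_eval : forall k (g : F) n,
  submod_set (hull_submod (holo_fun G) [set V k : weight R G]) g ->
  cnorm (g (z n)) <= c k * pnorm (V k) g.

(** Under an induced topology the interior of the ball S would be the preimage of an open set around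
    phi 0. Some f_j would then lie in S, against [peaked]. The target is left general, to serve for
    both inclusions. *)
Lemma not_induced (T : topologicalType) (phi : VH V -> T) :
  (forall U : set T, nbhs (phi 0) U -> exists j, U (phi (f j))) ->
  ~ induced_topology phi.
Proof.
move=> H ind; have S0 := VH_nbhs_sup step_eval 0 ltr01.
set S := [set g | _] in S0.
have [/(_ (open_interior S)) [B oB BE] _] := ind S°.
have B0 : B (phi 0) by have : S° 0 by []; rewrite -BE.
have [j Bj] := H B (open_nbhs_nbhs (conj oB B0)).
have [n fn] := peaked j.
have : S° (f j) by rewrite -BE.
move=> /interior_subset/(_ n); rewrite subr0 => h.
by move: (lt_trans fn h); rewrite ltxx.
Qed.

(** Precompactness would give the sequence a cluster point g. Pointwise convergence forces g(z_n) =
    0 for all n, while closeness to g holds uniformly in n and contradicts [peaked]. *)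
Lemma not_montel k M :
  (forall j, submod_set (hull_submod (holo_fun G) [set V k : weight R G]) (vh (f j))) ->
  (forall j, pnorm (V k) (vh (f j)) <= M) ->
  (forall n e, 0 < e -> exists J, forall j, (J <= j)%N -> cnorm (vh (f j) (z n)) <= e) ->
  ~ montel (VH V).
Proof.
move=> fk fM f0 [_ _ /(_ _ (VH_bounded_seq fk fM))].
rewrite precompactE => /(_ (f @ \oo) _)[|g [_ gf]].
  by exists 0%N => // j _; apply: subset_closure; exists j.
have near_g e J : 0 < e -> exists2 j, (J <= j)%N &
    forall n, cnorm (vh (f j) (z n) - vh g (z n)) < e.
  move=> e0; have FJ : (f @ \oo) [set f j | j in [set j | (J <= j)%N]].
    by exists J => // j; exists j.
  by have [_ [[j Jj <-] h]] := gf _ _ FJ (VH_nbhs_sup step_eval g e0); exists j.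
have g0 n : vh g (z n) = 0.
  apply: ComplexField.Normc.eq0_normc; apply/le_anti; rewrite cnorm_ge0 andbT.
  apply/ler_addgt0Pr => e e0; rewrite add0r; have e20 : 0 < e / 2 by lra.
  have [J JP] := f0 n _ e20; have [j /JP h1 /(_ n)/ltW h2] := near_g _ J e20.
  have := cnormD (vh (f j) (z n)) (- (vh (f j) (z n) - vh g (z n))).
  by rewrite cnormN opprB addrCA subrr addr0; lra.
have [j _ jP] := near_g 1 0%N ltr01; have [n fn] := peaked j.
by have := jP n; rewrite g0 subr0 => h; move: (lt_trans fn h); rewrite ltxx.
Qed.

End NotInduced.

Section ProjectiveHull.
Hypothesis zG : forall n, G (z n).
Hypothesis eval_bounded : forall B : set (HVbar V), tvs_bounded B ->
  exists c, forall g n, B g -> cnorm (hv g (z n)) <= c.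
Hypothesis small : forall v e, Vbar V v -> 0 < e ->
  exists J, forall j, (J <= j)%N -> pnorm v (vh (f j)) <= e.

Lemma HVbar_nbhs0_seq (U : set (HVbar V)) :
  nbhs (0 : HVbar V) U -> exists j, U (VH_to_HVbar V (f j)).
Proof.
move=> /HVbar_nbhs0P[n [v [e [e0 Vv vU]]]]; have e20 : 0 < e / 2 by lra.
have /choice[J JP] i := small (Vv i) e20.
exists (\max_(i < n) J i)%N; apply: vU => i; rewrite hv_VH.
by apply: (@le_lt_trans _ _ (e / 2)); [apply: JP; exact: leq_bigmax|lra].
Qed.

Let U : set (HVbar V) := [set g | forall n, cnorm (hv g (z n)) <= 1].

Lemma eval_ball_nbhs : ~ nbhs (0 : HVbar V) U.
Proof.
move=> /HVbar_nbhs0_seq[j jP]; have [n] := peaked j.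
by rewrite ltNge; have := jP n; rewrite hv_VH => ->.
Qed.

Lemma not_bornological : ~ bornological (HVbar V).
Proof.
move=> /(_ U) H; apply: eval_ball_nbhs; apply: H.
  split; last first.
    move=> a g a1 Ug n; rewrite hvZ cnormM.
    by rewrite mulr_ile1 ?cnorm_ge0.
  apply/convex_setW => x y; rewrite !inE => hx hy k k0 k1; rewrite inE => n.
  rewrite -[X in hv X]/(k%:num *: x + (1 - k%:num) *: y) hvD !hvZ.
  have kr : (complex.Re k%:num)%:C%C = k%:num.
    by move: k0; case: (k%:num) => a b; rewrite ltcE /= => /andP[/eqP -> _].
  have r0 : 0 < complex.Re k%:num by rewrite -ltcR kr.
  have r1 : complex.Re k%:num < 1 by rewrite -ltcR kr.
  have -> : 1 - k%:num = (1 - complex.Re k%:num)%:C%C by rewrite rmorphB /= kr.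
  rewrite -kr; apply: (le_trans (cnormD _ _)); rewrite !cnormM !cnorm_real.
  rewrite !gtr0_norm ?subr_gt0 //.
  by have := hx n; have := hy n; move: r0 r1; set r := complex.Re _; nra.
move=> B /eval_bounded[c cP]; exists (`|c| + 1); first by rewrite ltr_wpDl.
move=> a ac g Bg; have c0 : 0 <= `|c| by [].
have a0 : 0 < cnorm a by lra.
have aN0 : a != 0.
  by apply/eqP => aE; move: a0; rewrite aE [cnorm 0]ComplexField.Normc.normc0 ltxx.
exists (a^-1 *: g); last by rewrite scalerA mulfV // scale1r.
move=> n; rewrite hvZ cnormM cnormV mulrC ler_pdivrMr // mul1r.
by have := cP g n Bg; have := ler_norm c; lra.
Qed.

Lemma equicontinuous_eval n v : Vbar V v ->
  equicontinuous_forms [set (eval (z n) : {linear HVbar V -> C^o})].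
Proof.
move=> Vv g E /=; rewrite -entourage_ballE => -[e /= e0 eE].
have rE : (complex.Re e)%:C%C = e.
  by move: e0; case: (e) => x y; rewrite ltcE /= => /andP[/eqP -> _].
have r0 : 0 < complex.Re e by rewrite -ltcR rE.
apply: (@filterS _ (nbhs g) (nbhs_filter g) _ _ _ (HVbar_eval_nbhs g Vv (zG n) r0)).
move=> h /= hh _ ->; apply: eE => /=.
by rewrite -ball_normE /= distrC normr_cnorm -rE ltcR.
Qed.

(** The evaluations at the z_n, taken as singletons, are equicontinuous, and [eval_bounded] makes
    their union strongly bounded. Equicontinuity of the union at 0 would make U a neighbourhood of
    0. *)
Lemma not_DF v : Vbar V v -> ~ DF_space (HVbar V).
Proof.
move=> Vv [_ H]; pose M n := [set (eval (z n) : {linear HVbar V -> C^o})].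
have M_bounded : strongly_bounded (\bigcup_n M n).
  move=> B /eval_bounded[c cP]; exists c => _ g [n _ ->] Bg; exact: cP.
have e0 : (0 : C) < 1 by [].
have := H M (fun n => equicontinuous_eval n Vv) M_bounded 0 _
  (@entourage_ball C C^o (PosNum e0)).
move=> h; apply: eval_ball_nbhs.
apply: (@filterS _ (nbhs (0 : HVbar V)) (nbhs_filter _) _ _ _ h) => g /= hg n.
have := hg (eval (z n)) (ex_intro2 _ _ n I erefl).
rewrite -ball_normE /= normr_cnorm ltcR => g1.
have : cnorm ((0 : C) - hv g (z n)) <= 1 by exact: ltW g1.
by rewrite sub0r cnormN.
Qed.

End ProjectiveHull.

End PeakingSequence.

(** * Splitting the peaks by continuous cut-offs *)

Section PeaksInVC.
Context {R : realType} {Lam : weight_seq R [set: nat]} {w : nat -> R -> R}.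
Hypothesis Lam_bounds : forall k n : nat, (n.+1%:R ^+ 2)^-1 <= Lam k n <= 1.
Hypothesis hw : angular_weights Lam w.
Local Notation C := R[i].
Local Notation X := (C^o * C^o)%type.
Local Notation V := (v_seq hw).

Lemma peak_step k j :
  submod_set (hull_submod (holo_fun (@G12 R)) [set V k : weight R (@G12 R)]) (peak j).
Proof.
split; first exact: peak_holo.
move=> _ ->; apply: (@wvalues_le _ _ _ _ _ 2) => z Gz.
have := V_le1 Lam_bounds hw k Gz; have := wfun_gt0 (V k) Gz.
by have := peak_le2 j z; have := cnorm_ge0 (peak j z); nra.
Qed.

Lemma pnorm_peak_le2 k j : pnorm (V k) (peak j) <= 2.
Proof.
apply: pnorm_le => // z Gz.
have := V_le1 Lam_bounds hw k Gz; have := wfun_gt0 (V k) Gz.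
by have := peak_le2 j z; have := cnorm_ge0 (peak j z); nra.
Qed.

Lemma peak_ind j : submod_set (ind_submod V (holo_fun (@G12 R))) (peak j).
Proof. by exists 0%N => //; exact: peak_step. Qed.

Definition peak_VH j : VH V := to_subsp (peak_ind j).

Lemma vh_peak j : vh (peak_VH j) = peak j. Proof. by []. Qed.

Definition cut_peak (phi : X -> R) j : X -> C^o := fun z => (phi z)%:C%C * peak j z.

Lemma cut_peak_step (phi : X -> R) j k : continuous phi -> (forall z, 0 <= phi z <= 1) ->
  submod_set (hull_submod (cont_fun (@G12 R)) [set V k : weight R (@G12 R)])
    (cut_peak phi j).
Proof.
move=> phic phi01; have [pc p0] := holo_cont (peak_holo (R := R) j).
have phiC : continuous (fun z : X => (phi z)%:C%C : C^o).
  move=> z; apply/(@cvgrPdist_lt _ _ _ (nbhs z) (nbhs_filter z)) => e e0.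
  have rE : (complex.Re e)%:C%C = e.
    by move: e0; case: (e) => x y; rewrite ltcE /= => /andP[/eqP -> _].
  have r0 : 0 < complex.Re e by rewrite -ltcR rE.
  have := @cvgrPdist_lt _ _ _ (nbhs z) (nbhs_filter z) phi (phi z).
  move=> [+ _] => /(_ (phic z) _ r0).
  apply: (@filterS _ (nbhs z) (nbhs_filter z)) => y /= h.
  by rewrite -rmorphB normr_cnorm cnorm_real -rE ltcR.
split.
  split; last by move=> z nGz; rewrite /cut_peak p0 // mulr0.
  move=> z; apply: cvgM; last exact: pc.
  exact: (continuous_subspaceT phiC).
move=> _ ->; apply: (@wvalues_le _ _ _ _ _ 2) => z Gz.
have /andP[f0 f1] := phi01 z.
have := V_le1 Lam_bounds hw k Gz; have := wfun_gt0 (V k) Gz.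
rewrite /cut_peak cnormM cnorm_real ger0_norm //.
have := peak_le2 j z; have := cnorm_ge0 (peak j z).
move: (cnorm _) (V k z) (phi z) f0 f1 => a b c c0 c1 a0 a2 b0 b1.
have : c * a <= 2 by nra.
have : 0 <= c * a by rewrite mulr_ge0.
by nra.
Qed.

(* On [|z2| <= T + 1] the peaks are small for a weight [V K] with [K >= T + 1],
   because [V K] decays at the boundary of [G1]; on [|z2| >= T] they are small
   for [V 1], uniformly in [j]. *)
Lemma peak_VC_split (c : nat -> R) (e : R) : (forall k, 0 < c k) -> 0 < e ->
  exists J, forall j, (J <= j)%N -> exists k l (f1 f2 : X -> C^o),
    [/\ submod_set (hull_submod (cont_fun (@G12 R)) [set V k : weight R (@G12 R)]) f1,
        submod_set (hull_submod (cont_fun (@G12 R)) [set V l : weight R (@G12 R)]) f2,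
        vh (peak_VH j) = f1 + f2 &
        c k * pnorm (V k) f1 + c l * pnorm (V l) f2 <= e].
Proof.
move=> c0 e0.
(* Each piece may contribute e / 2, and the bound 2 for the peaks takes another factor 2. *)
have e1 : 0 < e / 4 / c 1%N by rewrite !divr_gt0.
have [T T0 TP] := V_far_small Lam_bounds hw e1.
pose K := Num.bound (T + 1).
have TK : T + 1 < K%:R by apply: archi_boundP; lra.
have e2 : 0 < e / 4 / c K.+1 by rewrite !divr_gt0.
have [d d0 dP] := V_bdry_small Lam_bounds hw e2.
have [J JP] := peak_small_inside d0 e2.
exists J => j Jj.
(* This cut-off is 1 for |z2| <= T and 0 for |z2| >= T + 1. *)
pose phi (z : X) : R := Num.min 1 (Num.max 0 (T + 1 - cnorm z.2)).
have c2 : continuous (fun y : X => cnorm y.2 : R).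
  by move=> y; apply: (@continuous_comp X C^o R (@snd C^o C^o) (fun x => cnorm x));
    [exact: cvg_snd|exact: continuous_cnorm].
have phic : continuous phi.
  move=> z; apply: (@continuous_min R X (fun=> 1) (fun y => Num.max 0 (T + 1 - cnorm y.2))).
    exact: cvg_cst.
  apply: (@continuous_max R X (fun=> 0) (fun y => T + 1 - cnorm y.2)).
    exact: cvg_cst.
  by apply: cvgB; [exact: cvg_cst|exact: c2].
have phi01 z : 0 <= phi z <= 1.
  by rewrite /phi le_min ler01 le_max lexx ge_min lexx.
pose psi (z : X) : R := 1 - phi z.
have psic : continuous psi.
  by move=> z; apply: cvgB; [exact: cvg_cst|exact: phic].
have psi01 z : 0 <= psi z <= 1 by have := phi01 z; rewrite /psi; lra.
exists K.+1, 1%N, (cut_peak phi j), (cut_peak psi j); split.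
- exact: cut_peak_step.
- exact: cut_peak_step.
- rewrite vh_peak; apply: funext => z; rewrite fctE /cut_peak -mulrDl -rmorphD.
  by rewrite /psi addrCA subrr addr0 mul1r.
have h1 : pnorm (V K.+1) (cut_peak phi j) <= e / 2 / c K.+1.
  apply: pnorm_le; first by rewrite !divr_ge0 // ltW.
  move=> z Gz; rewrite /cut_peak cnormM cnorm_real.
  have /andP[f0 f1] := phi01 z; rewrite ger0_norm //.
  have z0 := cnorm_ge0 (peak j z); have z2 := peak_le2 j z.
  have V0 := wfun_gt0 (V K.+1) Gz; have V1 := V_le1 Lam_bounds hw K.+1 Gz.
  have eE : e / 2 / c K.+1 = 2 * (e / 4 / c K.+1).
    by field; exact: lt0r_neq0.
  have [hT|hT] := leP (T + 1) (cnorm z.2).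
    have -> : phi z = 0.
      by rewrite /phi (max_l _) ?subr_le0 // min_r.
    by rewrite mul0r mulr0 !divr_ge0 // ltW.
  have : phi z * cnorm (peak j z) <= cnorm (peak j z) by rewrite ler_piMl.
  have : 0 <= phi z * cnorm (peak j z) by rewrite mulr_ge0.
  have [hd|/ltW hd] := leP (dist_compl z.1) d.
    have := dP K z Gz (ltW (lt_trans hT TK)) hd.
    rewrite eE; move: (V _ z) (phi z * _) (e / 4 / _) V0 V1 e2 => a b g; nra.
  have := JP j z Jj Gz hd.
  rewrite eE; move: (V _ z) (phi z * _) (e / 4 / _) V0 V1 e2 => a b g; nra.
have h2 : pnorm (V 1%N) (cut_peak psi j) <= e / 2 / c 1%N.
  apply: pnorm_le; first by rewrite !divr_ge0 // ltW.
  move=> z Gz; rewrite /cut_peak cnormM cnorm_real.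
  have /andP[f0 f1] := psi01 z; rewrite ger0_norm //.
  have z0 := cnorm_ge0 (peak j z); have z2 := peak_le2 j z.
  have V0 := wfun_gt0 (V 1%N) Gz.
  have eE : e / 2 / c 1%N = 2 * (e / 4 / c 1%N).
    by field; exact: lt0r_neq0.
  have [hT|/ltW hT] := leP T (cnorm z.2); last first.
    have -> : psi z = 0.
      rewrite /psi /phi (max_r _); last by lra.
      by rewrite min_l ?subrr //; lra.
    by rewrite mul0r mulr0 !divr_ge0 // ltW.
  have : psi z * cnorm (peak j z) <= cnorm (peak j z) by rewrite ler_piMl.
  have : 0 <= psi z * cnorm (peak j z) by rewrite mulr_ge0.
  have := TP z Gz hT.
  rewrite eE; move: (V _ z) (psi z * _) (e / 4 / _) V0 e1 => a b g; nra.
rewrite ler_pdivlMr // in h1; rewrite ler_pdivlMr // in h2.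
by rewrite [c K.+1 * _]mulrC [c 1%N * _]mulrC; lra.
Qed.

Lemma peak_zpt_small n (e : R) : 0 < e ->
  exists J, forall j, (J <= j)%N -> cnorm (peak j (zpt n : X)) <= e.
Proof.
move=> e0; have [Gn _ _] := @zptP R n; have /dist_compl_itv/andP[d0 _] := Gn.
by have [J JP] := peak_small_inside d0 e0; exists J => j Jj; exact: JP.
Qed.

End PeaksInVC.

Theorem theorem5 (R : realType) (Lam : weight_seq R [set: nat])
  (Lam_bounds : forall k n : nat, (n.+1%:R ^+ 2)^-1 <= Lam k n <= 1)
  (K_not_bornological : ~ bornological (K_infty Lam))
  (K_not_metrizable : exists2 B : set (K_infty Lam),
     tvs_bounded B & ~ metrizable_set R B)
  (w : nat -> R -> R) (hw : angular_weights Lam w) :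
  let V := v_seq hw in
  [/\ ~ bornological (HVbar V),
      ~ induced_topology (VH_to_HVbar V),
      ~ induced_topology (VH_to_VC V),
      ~ montel (VH V) &
      ~ DF_space (HVbar V)].
Proof.
move=> V; pose f : nat -> VH V := peak_VH Lam_bounds hw.
have peaked j : exists n, 1 < cnorm (vh (f j) (zpt n)) := peak_near1 j.
have step_eval k g n := @step_zpt_bound R Lam w Lam_bounds hw k g n.
have bounded := HVbar_zpt_bounded Lam_bounds (hw := hw).
have zG n : G12 (@zpt R n) by have [] := @zptP R n.
have small v e : Vbar V v -> 0 < e ->
    exists J, forall j, (J <= j)%N -> pnorm v (vh (f j)) <= e.
  by move=> [dv _] e0; exact: (peak_dominated_small Lam_bounds dv e0).
have cst1 : continuous (fun _ : R => 1 : R) by move=> x; exact: cvg_cst.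
(* D = 1 provides a member of [Vbar], by which the single evaluations are continuous. *)
have [v Vv _] := Vbar_weight Lam_bounds hw cst1 (fun s t _ => lexx 1) (fun t => lexx 1).
have incl0 : VH_to_HVbar V 0 = 0 by exact: val_inj.
have inclC0 : VH_to_VC V 0 = 0 by exact: val_inj.
split.
- exact: (not_bornological peaked bounded small).
- apply: (not_induced peaked step_eval); rewrite incl0.
  exact: (HVbar_nbhs0_seq small).
- apply: (not_induced peaked step_eval); rewrite inclC0.
  apply: VC_nbhs0; exact: peak_VC_split.
- apply: (not_montel peaked step_eval (k := 0) (M := 2)).
  + by move=> j; exact: peak_step.
  + by move=> j; exact: pnorm_peak_le2.
  + by move=> n e; exact: peak_zpt_small.
- exact: (not_DF peaked zG bounded small Vv).
Qed.
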